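(* Let $\gamma_1,\gamma_2,\gamma_3,\delta_1,\delta_2,\delta_3,x,y\in\mathbb{C}$ with $\operatorname{Re}\gamma_1>0$, $\operatorname{Re}\gamma_2>0$, $\operatorname{Re}(\delta_1-\gamma_1-\gamma_2)>0$, and let $\alpha_2,\alpha_3,\alpha_4,\beta_1,\beta_2,\beta_4$ be positive real numbers with $\alpha_3-\alpha_2>0$. Then $$D_1\left(\begin{matrix}\gamma_1,\alpha_3-\alpha_2,\beta_1;\gamma_2,\alpha_2;\gamma_3,\beta_2;\\ \delta_1,\alpha_3,\beta_1;\delta_2,\alpha_4;\delta_3,\beta_4;\end{matrix}\left|\begin{matrix}x\\ y\end{matrix}\right.\right)=\frac{1}{\Gamma(\gamma_1)\Gamma(\gamma_2)\Gamma(\delta_1-\gamma_1-\gamma_2)}$$ $$\times\int_0^1\!\!\int_0^1\xi^{\gamma_2-1}\eta^{\gamma_1-1}(1-\xi)^{\delta_1-\gamma_2-1}(1-\eta)^{\delta_1-\gamma_1-\gamma_2-1}E_{\alpha_4,\delta_2}\left(x\,\xi^{\alpha_2}[(1-\xi)\eta]^{\alpha_3-\alpha_2}\right)E_{\beta_4,\delta_3}^{\gamma_3,\beta_2}\left(y(1-\xi)^{\beta_1}\eta^{\beta_1}\right)d\xi\,d\eta.$$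
   Context: $(\gamma)_\lambda=\Gamma(\gamma+\lambda)/\Gamma(\gamma)$ for $\gamma\in\mathbb{C}$ and real $\lambda\ge0$. For complex $\gamma_i,\delta_i,x,y$ and positive real $\alpha_i,\beta_i$, $$D_1\left(\begin{matrix}\gamma_1,\alpha_1,\beta_1;\gamma_2,\alpha_2;\gamma_3,\beta_2;\\ \delta_1,\alpha_3,\beta_3;\delta_2,\alpha_4;\delta_3,\beta_4;\end{matrix}\left|\begin{matrix}x\\ y\end{matrix}\right.\right)=\sum_{m,n=0}^{\infty}\frac{(\gamma_1)_{\alpha_1 m+\beta_1 n}(\gamma_2)_{\alpha_2 m}(\gamma_3)_{\beta_2 n}}{\Gamma(\delta_1+\alpha_3 m+\beta_3 n)}\frac{x^m}{\Gamma(\delta_2+\alpha_4 m)}\frac{y^n}{\Gamma(\delta_3+\beta_4 n)}.$$ The one-variable functions are $$E_{a,\delta}(z)=\sum_{m=0}^\infty\frac{z^m}{\Gamma(am+\delta)},\qquad E_{a,\delta}^{\gamma,b}(z)=\sum_{n=0}^\infty\frac{(\gamma)_{bn}z^n}{\Gamma(an+\delta)}.$$ The functions are considered at arguments in the region of absolute convergence of their defining series. *)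

(* Defs.v *)
From HB Require Import structures.
From mathcomp Require Export all_boot all_order all_algebra.
From mathcomp Require Export all_classical all_reals all_analysis.
From mathcomp.real_closed Require Export complex.

Set Implicit Arguments.
Unset Strict Implicit.
Unset Printing Implicit Defensive.

Export Order.TTheory GRing.Theory Num.Theory.
Export numFieldNormedType.Exports.

Local Open Scope classical_set_scope.
Local Open Scope ring_scope.
Local Open Scope complex_scope.

Section ComplexAnalysis.
Context {R : realType}.
Implicit Types (z : R[i]).

Definition cexp z : R[i] :=
  (expR (complex.Re z) * cos (complex.Im z)) +i*
  (expR (complex.Re z) * sin (complex.Im z)).

(* t^z for t > 0, with the real logarithm of t; only used for t > 0. *)
Definition cpow (t : R) z : R[i] := cexp (z * (ln t)%:C).

Definition csummable (T : choiceType) (u : T -> R[i]) : Prop :=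
  summable [set: T] (fun i => (Normc.normc (u i))%:E).

(* Meaningful for convergent series; an unspecified value otherwise. *)
Definition cseries (u : nat -> R[i]) : R[i] :=
  limn (series (fun n => complex.Re (u n))) +i*
  limn (series (fun n => complex.Im (u n))).

Definition cintegrable d (T : measurableType d)
    (mu : {measure set T -> \bar R}) (D : set T) (f : T -> R[i]) : Prop :=
  mu.-integrable D (fun s => (complex.Re (f s))%:E) /\
  mu.-integrable D (fun s => (complex.Im (f s))%:E).

Definition cintegral d (T : measurableType d)
    (mu : {measure set T -> \bar R}) (D : set T) (f : T -> R[i]) : R[i] :=
  Rintegral mu D (fun s => complex.Re (f s)) +i*
  Rintegral mu D (fun s => complex.Im (f s)).

(* Euler's integral, convergent for Re z > 0. *)
Definition Gamma_integral z : R[i] :=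
  cintegral (@lebesgue_measure R) `]0, +oo[
    (fun t => cpow t (z - 1) * (expR (- t))%:C).

(* Meromorphic continuation: Gamma z = Gamma (z + k) / (z (z+1) ... (z+k-1)),
   where k is the least natural number with Re (z + k) > 0.  At a pole of Gamma
   the product vanishes, so Gamma z = 0 and 1 / Gamma z = 0 there; the latter is
   the value of the entire function 1 / Gamma. *)
Definition Gamma z : R[i] :=
  let k := Num.truncn (1 - complex.Re z) in
  Gamma_integral (z + k%:R) / \prod_(i < k) (z + i%:R).

Definition Gamma_pole z : Prop := exists k : nat, z = - k%:R.

(* Gamma (g + l) / Gamma g.  When g is a pole and l is a natural number the
   quotient has a removable singularity, and is the rising factorial. *)
Definition pochhammer (g : R[i]) (l : R) : R[i] :=
  if `[< Gamma_pole g >] && (l \is a Num.nat)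
  then \prod_(i < Num.truncn l) (g + i%:R)
  else Gamma (g + l%:C) / Gamma g.

(* Mittag-Leffler functions: ML2 a delta z is E_{a,delta}(z), and
   ML4 a delta gamma b z is E_{a,delta}^{gamma,b}(z). *)
Definition ML2_term (a : R) (delta z : R[i]) (m : nat) : R[i] :=
  z ^+ m / Gamma ((a * m%:R)%:C + delta).

Definition ML2 (a : R) (delta z : R[i]) : R[i] := cseries (ML2_term a delta z).

Definition ML4_term (a : R) (delta gamma : R[i]) (b : R) (z : R[i]) (n : nat) :
    R[i] :=
  pochhammer gamma (b * n%:R) * z ^+ n / Gamma ((a * n%:R)%:C + delta).

Definition ML4 (a : R) (delta gamma : R[i]) (b : R) (z : R[i]) : R[i] :=
  cseries (ML4_term a delta gamma b z).

Definition D1_term (gamma1 : R[i]) (alpha1 beta1 : R) (gamma2 : R[i])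
    (alpha2 : R) (gamma3 : R[i]) (beta2 : R) (delta1 : R[i]) (alpha3 beta3 : R)
    (delta2 : R[i]) (alpha4 : R) (delta3 : R[i]) (beta4 : R) (x y : R[i])
    (m n : nat) : R[i] :=
  pochhammer gamma1 (alpha1 * m%:R + beta1 * n%:R)
    * pochhammer gamma2 (alpha2 * m%:R) * pochhammer gamma3 (beta2 * n%:R)
    / Gamma (delta1 + (alpha3 * m%:R + beta3 * n%:R)%:C)
  * (x ^+ m / Gamma (delta2 + (alpha4 * m%:R)%:C))
  * (y ^+ n / Gamma (delta3 + (beta4 * n%:R)%:C)).

Definition D1_summable gamma1 alpha1 beta1 gamma2 alpha2 gamma3 beta2
    delta1 alpha3 beta3 delta2 alpha4 delta3 beta4 x y : Prop :=
  csummable (fun p : nat * nat =>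
    D1_term gamma1 alpha1 beta1 gamma2 alpha2 gamma3 beta2
      delta1 alpha3 beta3 delta2 alpha4 delta3 beta4 x y p.1 p.2).

(* Iterated sum; under D1_summable the order of summation is immaterial. *)
Definition D1 gamma1 alpha1 beta1 gamma2 alpha2 gamma3 beta2
    delta1 alpha3 beta3 delta2 alpha4 delta3 beta4 x y : R[i] :=
  cseries (fun m => cseries (fun n =>
    D1_term gamma1 alpha1 beta1 gamma2 alpha2 gamma3 beta2
      delta1 alpha3 beta3 delta2 alpha4 delta3 beta4 x y m n)).

(* Lebesgue measure on the plane and the open unit square; the integrands may
   be singular on the boundary of the square, which is a null set. *)
Definition lebesgue2 :=
  (@lebesgue_measure R \x @lebesgue_measure R)%E.

Definition unit_square : set (measurableTypeR R * measurableTypeR R) :=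
  `]0, 1[ `*` `]0, 1[.

End ComplexAnalysis.

(* Main.v *)
Require Import Defs.
From mathcomp Require Import measurable_realfun ring lra.

Set Implicit Arguments.
Unset Strict Implicit.
Unset Printing Implicit Defensive.

Local Open Scope classical_set_scope.
Local Open Scope ring_scope.
Local Open Scope complex_scope.

Local Notation Re := complex.Re.
Local Notation Im := complex.Im.
Local Notation normc := Normc.normc.

(** Both one-variable series are expanded in powers of x and y.  The (m, n)
    term of the integrand then separates into a product of two Beta integrands,
      xi^(a-1) (1-xi)^(b-1)  and  eta^(c-1) (1-eta)^(e-1)
    with a = gamma2 + alpha2 m, b = delta1 - gamma2 + L, c = gamma1 + L,
    e = delta1 - gamma1 - gamma2 and L = (alpha3 - alpha2) m + beta1 n.  Since
    c + e = b and a + b = delta1 + alpha3 m + beta1 n, the product of the two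
    Beta values telescopes to
      Gamma a Gamma c Gamma e / Gamma (a + b),
    which, multiplied by the coefficients of the two series, is the (m, n) term
    of D1 up to the factor
    Gamma gamma1 Gamma gamma2 Gamma (delta1 - gamma1 - gamma2)
    (cintegral_term).

    Exchanging sums and integral needs the sum of the integrals of the moduli.
    The modulus of a Beta integrand is the Beta integrand at the real parts of
    its parameters, so the question is how Gamma (Re z) compares with |Gamma z|
    along the shifts.  In denominators |Gamma z| <= Gamma (Re z) suffices.  In
    numerators one uses that |Gamma z| / Gamma (Re z) does not decrease when z
    moves to the right (normc_Gamma_ratio), which is the triangle inequality for
    a Beta integral.  Hence each integral of a modulus is at most a fixed
    multiple of the modulus of the D1 term (normc_term_bound), and absolute
    convergence of D1 allows dominated convergence in n and then in m
    (cintegral_double_series).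

    The comparison also needs Gamma to have no zero with positive real part
    (Gamma_integral_neq0).  For large real part this follows from concentration
    of the Gamma law around its mean; the recurrence Gamma (z + 1) = z Gamma z
    transports it to the left.  Euler's relation between Gamma and Beta
    (Gamma_integral_Beta) is obtained from Fubini's theorem for the convolution
    of two Gamma kernels, after one translation and one dilation. *)

(** * Real and imaginary parts, modulus *)

Section ComplexNumbers.
Context {R : realType}.
Implicit Types (z w : R[i]) (r : R).

Lemma complex_ext z w : Re z = Re w -> Im z = Im w -> z = w.
Proof. by case: z w => [a b] [c d] /= -> ->. Qed.

Lemma ReD z w : Re (z + w) = Re z + Re w.
Proof. by case: z w => [a b] [c d]. Qed.

Lemma ImD z w : Im (z + w) = Im z + Im w.
Proof. by case: z w => [a b] [c d]. Qed.

Lemma ReN z : Re (- z) = - Re z.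
Proof. by case: z. Qed.

Lemma ImN z : Im (- z) = - Im z.
Proof. by case: z. Qed.

Lemma ReB z w : Re (z - w) = Re z - Re w.
Proof. by rewrite ReD ReN. Qed.

Lemma ImB z w : Im (z - w) = Im z - Im w.
Proof. by rewrite ImD ImN. Qed.

Lemma ReM z w : Re (z * w) = Re z * Re w - Im z * Im w.
Proof. by case: z w => [a b] [c d]. Qed.

Lemma ImM z w : Im (z * w) = Re z * Im w + Im z * Re w.
Proof. by case: z w => [a b] [c d]. Qed.

Lemma Re_nat n : Re (n%:R : R[i]) = n%:R.
Proof. by rewrite -(rmorph_nat (real_complex R)). Qed.

Lemma normcE z : normc z = Num.sqrt (Re z ^+ 2 + Im z ^+ 2).
Proof. by case: z. Qed.

Lemma normc_ge0 z : 0 <= normc z.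
Proof. by rewrite normcE sqrtr_ge0. Qed.

Lemma normc_real r : normc r%:C = `|r|.
Proof. by rewrite normcE /= expr0n addr0 sqrtr_sqr. Qed.

Lemma Re_le_normc z : `|Re z| <= normc z.
Proof.
by rewrite normcE -sqrtr_sqr ler_wsqrtr // lerDl sqr_ge0.
Qed.

Lemma Im_le_normc z : `|Im z| <= normc z.
Proof.
by rewrite normcE -sqrtr_sqr ler_wsqrtr // lerDr sqr_ge0.
Qed.

Lemma normc_le_ReIm z : normc z <= `|Re z| + `|Im z|.
Proof.
rewrite normcE -[leRHS]ger0_norm ?addr_ge0// -sqrtr_sqr ler_wsqrtr //.
rewrite sqrrD !real_normK ?num_real// lerD2r lerDl.
by rewrite mulrn_wge0// mulr_ge0.
Qed.

Lemma normc_gt0 z : (0 < normc z) = (z != 0).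
Proof.
rewrite lt_neqAle normc_ge0 andbT eq_sym; congr (~~ _).
by apply/eqP/eqP => [/Normc.eq0_normc|->]; rewrite ?Normc.normc0.
Qed.

(** A rotation turns any complex number into its modulus. *)
Lemma normc_rotate z : exists2 c, normc c = 1 & c * z = (normc z)%:C.
Proof.
have [->|z0] := eqVneq z 0.
  by exists 1; rewrite ?Normc.normc1// mulr0 Normc.normc0.
exists ((normc z)%:C / z).
  rewrite Normc.normcM normc_real ger0_norm ?normc_ge0// Normc.normcV.
  by rewrite divff// gt_eqF// normc_gt0.
by rewrite divfK.
Qed.

End ComplexNumbers.

(** * Integration of complex-valued functions *)

Definition cmeasurable d (T : measurableType d) (R : realType) (D : set T)
    (f : T -> R[i]) : Prop :=
  measurable_fun D (fun x => Re (f x)) /\ measurable_fun D (fun x => Im (f x)).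

(** Outside D the value is the zero of the field, not the point of a pointed
    type. *)
Definition czero_ext (T : Type) (R : realType) (D : set T) (f : T -> R[i]) :
  T -> R[i] := fun x => if x \in D then f x else 0.

Section ComplexMeasurable.
Context {d} {T : measurableType d} {R : realType}.
Implicit Types (D : set T) (f g : T -> R[i]).

Lemma cmeasurable_cst D (c : R[i]) : cmeasurable D (fun=> c).
Proof. by split; exact: measurable_cst. Qed.

Lemma cmeasurable_real D (f : T -> R) :
  measurable_fun D f -> cmeasurable D (fun x => (f x)%:C).
Proof. by move=> mf; split => //=; exact: measurable_cst. Qed.

Lemma cmeasurableM D f g :
  cmeasurable D f -> cmeasurable D g -> cmeasurable D (fun x => f x * g x).
Proof.
move=> [fr fi] [gr gi]; split.
  by under eq_fun do rewrite ReM; apply: measurable_funB; exact: measurable_funM.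
by under eq_fun do rewrite ImM; apply: measurable_funD; exact: measurable_funM.
Qed.

Lemma cmeasurable_normc D f :
  cmeasurable D f -> measurable_fun D (fun x => normc (f x)).
Proof.
move=> [fr fi]; under eq_fun do rewrite normcE.
have ms : measurable_fun setT (@Num.sqrt R).
  by apply: continuous_measurable_fun; exact: sqrt_continuous.
by apply: (measurableT_comp ms); apply: measurable_funD; exact: measurable_funX.
Qed.

Lemma cmeasurable_restrict D f : measurable D ->
  cmeasurable D f <-> cmeasurable setT (czero_ext D f).
Proof.
move=> mD.
have E (h : R[i] -> R) : h 0 = 0 -> (fun x => h (czero_ext D f x)) = (h \o f) \_ D.
  by move=> h0; apply/funext => x /=; rewrite /czero_ext !patchE; case: ifP.
rewrite /cmeasurable !E//.
by split=> -[mr mi]; split; apply/(measurable_restrictT _ mD).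
Qed.

End ComplexMeasurable.

Lemma cmeasurable_comp d d' (T : measurableType d) (T' : measurableType d')
    (R : realType) (h : T' -> R[i]) (phi : T -> T') :
  cmeasurable setT h -> measurable_fun setT phi ->
  cmeasurable setT (fun x => h (phi x)).
Proof.
move=> [hr hi] mphi; split.
  exact: (measurableT_comp hr mphi).
exact: (measurableT_comp hi mphi).
Qed.

Section ComplexIntegral.
Context {d} {T : measurableType d} {R : realType}.
Variable mu : {measure set T -> \bar R}.
Implicit Types (D : set T) (f g : T -> R[i]).

Lemma cintegrableP D f : measurable D ->
  cintegrable mu D f <->
  cmeasurable D f /\ (\int[mu]_(x in D) (normc (f x))%:E < +oo)%E.
Proof.
move=> mD; split=> [[ir ii]|[mf foo]].
  have mf : cmeasurable D f.
    split; apply/measurable_EFinP; first exact: measurable_int ir.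
    exact: measurable_int ii.
  split=> //.
  have /integrableP[_] := integrableD mD (integrable_abse ir) (integrable_abse ii).
  apply: le_lt_trans; apply: ge0_le_integral => //=.
  - by move=> x _; rewrite lee_fin normc_ge0.
  - by apply/measurable_EFinP; exact: cmeasurable_normc.
  - apply/measurable_EFinP; case: mf => mr mi.
    apply: measurableT_comp => //.
    by apply: measurable_funD; apply: measurableT_comp.
  - by move=> x _; rewrite lee_fin ger0_norm ?addr_ge0// normc_le_ReIm.
have mn : measurable_fun D (fun x => (normc (f x))%:E).
  by apply/measurable_EFinP; exact: cmeasurable_normc.
have dom (h : R[i] -> R) : (forall z, `|h z| <= normc z) ->
    measurable_fun D (h \o f) -> mu.-integrable D (EFin \o (h \o f)).
  move=> hn mh; apply/integrableP; split; first exact/measurable_EFinP.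
  apply: le_lt_trans foo; apply: ge0_le_integral => //=.
  - by apply/measurable_EFinP; exact: measurableT_comp.
  - by move=> x _; rewrite lee_fin.
have [mr mi] := mf; split; apply: dom => //; first exact: Re_le_normc.
exact: Im_le_normc.
Qed.

Lemma eq_cintegrable D f g : measurable D ->
  {in D, f =1 g} -> cintegrable mu D f -> cintegrable mu D g.
Proof.
move=> mD fg [ir ii]; split.
  by apply: eq_integrable ir => // x xD; rewrite fg.
by apply: eq_integrable ii => // x xD; rewrite fg.
Qed.

Lemma eq_cintegral D f g :
  {in D, f =1 g} -> cintegral mu D f = cintegral mu D g.
Proof.
by move=> fg; congr (_ +i* _); apply: eq_Rintegral => x xD; rewrite fg.
Qed.

Lemma cintegrable_mkcond D f : measurable D ->
  cintegrable mu D f <-> cintegrable mu setT (czero_ext D f).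
Proof.
move=> mD.
have E (h : R[i] -> R) : h 0 = 0 ->
    (fun x => (h (czero_ext D f x))%:E) = (fun x => (h (f x))%:E) \_ D.
  move=> h0; apply/funext => x /=; rewrite /czero_ext !patchE.
  by case: ifP => // _; rewrite h0.
rewrite /cintegrable !E//.
by split=> -[ir ii]; split; apply/(integrable_mkcond _ mD).
Qed.

Lemma cintegral_mkcond D f : cintegral mu D f = cintegral mu setT (czero_ext D f).
Proof.
by congr (_ +i* _); rewrite Rintegral_mkcond; apply: eq_Rintegral => x _ /=;
  rewrite /czero_ext !patchE; case: ifP.
Qed.

Lemma cintegrableZl D c f : measurable D ->
  cintegrable mu D f -> cintegrable mu D (fun x => c * f x).
Proof.
move=> mD /cintegrableP[]// mf foo; apply/cintegrableP => //; split.
  by apply: cmeasurableM => //; exact: cmeasurable_cst.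
under eq_integral do rewrite Normc.normcM EFinM.
rewrite ge0_integralZl//.
- by rewrite lte_mul_pinfty// lee_fin normc_ge0.
- by apply/measurable_EFinP; exact: cmeasurable_normc.
- by move=> x _; rewrite lee_fin normc_ge0.
- by rewrite lee_fin normc_ge0.
Qed.

Lemma cintegralZl D c f : measurable D -> cintegrable mu D f ->
  cintegral mu D (fun x => c * f x) = c * cintegral mu D f.
Proof.
move=> mD [ir ii]; apply: complex_ext; rewrite ?ReM ?ImM /=.
  under eq_Rintegral do rewrite ReM.
  rewrite RintegralB//; first by rewrite !RintegralZl.
    exact: (integrableZl mD (Re c) ir).
  exact: (integrableZl mD (Im c) ii).
under eq_Rintegral do rewrite ImM.
rewrite RintegralD//; first by rewrite !RintegralZl.
  exact: (integrableZl mD (Re c) ii).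
exact: (integrableZl mD (Im c) ir).
Qed.

Lemma cintegrableB D f g : measurable D -> cintegrable mu D f ->
  cintegrable mu D g -> cintegrable mu D (fun x => f x - g x).
Proof.
move=> mD [fr fi] [gr gi]; split.
  have := integrableB mD fr gr.
  by apply: eq_integrable => // x _ /=; rewrite ReB EFinB.
have := integrableB mD fi gi.
by apply: eq_integrable => // x _ /=; rewrite ImB EFinB.
Qed.

Lemma cintegralB D f g : measurable D -> cintegrable mu D f ->
  cintegrable mu D g ->
  cintegral mu D (fun x => f x - g x) = cintegral mu D f - cintegral mu D g.
Proof.
move=> mD [fr fi] [gr gi]; apply: complex_ext; rewrite ?ReB ?ImB /= -RintegralB//.
  by apply: eq_Rintegral => x _; rewrite ReB.
by apply: eq_Rintegral => x _; rewrite ImB.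
Qed.

Lemma Re_cintegral_ge0 D f : (forall x, D x -> 0 <= Re (f x)) ->
  0 <= Re (cintegral mu D f).
Proof. exact: Rintegral_ge0. Qed.

Lemma cintegral_normc D f :
  cintegral mu D (fun x => (normc (f x))%:C) =
  (fine (\int[mu]_(x in D) (normc (f x))%:E))%:C.
Proof. by apply: complex_ext => //=; rewrite /Rintegral integral0. Qed.

(** After a rotation the integral is nonnegative, hence equal to the integral of
    a real part, which is at most the integral of the modulus. *)
Lemma normc_cintegral_le D f : measurable D -> cintegrable mu D f ->
  ((normc (cintegral mu D f))%:E <= \int[mu]_(x in D) (normc (f x))%:E)%E.
Proof.
move=> mD fi; have [c c1 cE] := normc_rotate (cintegral mu D f).
have [ir _] := cintegrableZl c mD fi.
rewrite -[normc _]/(Re (normc _)%:C) -cE -cintegralZl//= /Rintegral.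
rewrite fineK; last exact: integrable_fin_num.
have [mf foo] := (cintegrableP f mD).1 fi.
apply: le_integral => //.
  apply/integrableP; split.
    by apply/measurable_EFinP; exact: cmeasurable_normc.
  by under eq_integral do rewrite /= ger0_norm ?normc_ge0//.
move=> x _; rewrite lee_fin (le_trans (ler_norm _))//.
by rewrite (le_trans (Re_le_normc _))// Normc.normcM c1 mul1r.
Qed.

End ComplexIntegral.

Section ComplexFubini.
Context {d1 d2} {T1 : measurableType d1} {T2 : measurableType d2} {R : realType}.
Variables (m1 : {sigma_finite_measure set T1 -> \bar R}).
Variables (m2 : {sigma_finite_measure set T2 -> \bar R}).
Implicit Types F : T1 * T2 -> R[i].

(** The inner real integrals are finite only almost everywhere, where they agree
   with the extended real ones of Fubini's theorem. *)
Let RFubini1 (F : T1 * T2 -> R) :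
  (m1 \x m2)%E.-integrable setT (fun p => (F p)%:E) ->
  Rintegral m1 setT (fun x => Rintegral m2 setT (fun y => F (x, y))) =
  Rintegral (m1 \x m2)%E setT F.
Proof.
move=> iF; rewrite /Rintegral -integral12_prod_meas1//; congr fine.
apply: ae_eq_integral => //.
- apply/measurable_EFinP; apply: measurableT_comp => //.
  exact: (measurable_fubini_F iF).
- exact: (measurable_fubini_F iF).
- have := ae_integrable1 iF; apply: filterS => x ix _.
  by rewrite /fubini_F fineK//; exact: integrable_fin_num ix.
Qed.

Let RFubini2 (F : T1 * T2 -> R) :
  (m1 \x m2)%E.-integrable setT (fun p => (F p)%:E) ->
  Rintegral m2 setT (fun y => Rintegral m1 setT (fun x => F (x, y))) =
  Rintegral (m1 \x m2)%E setT F.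
Proof.
move=> iF; rewrite /Rintegral -integral21_prod_meas1//; congr fine.
apply: ae_eq_integral => //.
- apply/measurable_EFinP; apply: measurableT_comp => //.
  exact: (measurable_fubini_G iF).
- exact: (measurable_fubini_G iF).
- have := ae_integrable2 iF; apply: filterS => x ix _.
  by rewrite /fubini_G fineK//; exact: integrable_fin_num ix.
Qed.

Lemma cFubini1 F : cintegrable (m1 \x m2)%E setT F ->
  cintegral m1 setT (fun x => cintegral m2 setT (fun y => F (x, y))) =
  cintegral (m1 \x m2)%E setT F.
Proof. by move=> [ir ii]; apply: complex_ext; exact: RFubini1. Qed.

Lemma cFubini2 F : cintegrable (m1 \x m2)%E setT F ->
  cintegral m2 setT (fun y => cintegral m1 setT (fun x => F (x, y))) =
  cintegral (m1 \x m2)%E setT F.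
Proof. by move=> [ir ii]; apply: complex_ext; exact: RFubini2. Qed.

Lemma cintegral_prod (A : set T1) (B : set T2) (f : T1 -> R[i]) (g : T2 -> R[i]) :
  measurable A -> measurable B -> cintegrable m1 A f -> cintegrable m2 B g ->
  cintegrable (m1 \x m2)%E (A `*` B) (fun p => f p.1 * g p.2) /\
  cintegral (m1 \x m2)%E (A `*` B) (fun p => f p.1 * g p.2) =
    cintegral m1 A f * cintegral m2 B g.
Proof.
move=> mA mB iA iB; have mAB := measurableX mA mB.
have E : czero_ext (A `*` B) (fun p : T1 * T2 => f p.1 * g p.2) =
    (fun p => (czero_ext A f) p.1 * (czero_ext B g) p.2).
  apply/funext => -[x y]; rewrite /czero_ext/= in_setX/=.
  by case: (x \in A) => /=; case: (y \in B) => /=; rewrite ?mulr0 ?mul0r.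
rewrite cintegral_mkcond [cintegral m1 _ _]cintegral_mkcond.
rewrite [cintegral m2 _ _]cintegral_mkcond E.
have -> : cintegrable (m1 \x m2)%E (A `*` B) (fun p => f p.1 * g p.2) <->
    cintegrable (m1 \x m2)%E setT
      (fun p => (czero_ext A f) p.1 * (czero_ext B g) p.2).
  by rewrite -E; exact: cintegrable_mkcond.
move/(cintegrable_mkcond _ _ mA) : iA; move/(cintegrable_mkcond _ _ mB): iB.
move: (czero_ext A f) (czero_ext B g) => {}f {}g {E mAB mA mB A B} ig if_.
have [mf foo] := (cintegrableP m1 f measurableT).1 if_.
have [mg goo] := (cintegrableP m2 g measurableT).1 ig.
have H : cintegrable (m1 \x m2)%E setT (fun p => f p.1 * g p.2).
  apply/cintegrableP => //.
  have mF : cmeasurable setT (fun p : T1 * T2 => f p.1 * g p.2).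
    by apply: cmeasurableM; exact: cmeasurable_comp.
  split=> //; rewrite fubini_tonelli1/=.
  - rewrite /fubini_F /=.
    have H x : (\int[m2]_y (normc (f x * g y))%:E =
        (normc (f x))%:E * \int[m2]_y (normc (g y))%:E)%E.
      under eq_integral do rewrite Normc.normcM EFinM.
      rewrite ge0_integralZl//.
      - by apply/measurable_EFinP; exact: cmeasurable_normc.
      - by move=> y _; rewrite lee_fin normc_ge0.
      - by rewrite lee_fin normc_ge0.
    under eq_integral do rewrite H muleC.
    rewrite ge0_integralZl//.
    + rewrite lte_mul_pinfty// ?integral_ge0// => [x _|].
        by rewrite lee_fin normc_ge0.
      rewrite ge0_fin_numE// integral_ge0// => x _; by rewrite lee_fin normc_ge0.
    + by apply/measurable_EFinP; exact: cmeasurable_normc.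
    + by move=> x _; rewrite lee_fin normc_ge0.
    + by rewrite integral_ge0// => x _; rewrite lee_fin normc_ge0.
  - by apply/measurable_EFinP; exact: cmeasurable_normc.
  - by move=> x; rewrite lee_fin normc_ge0.
split=> //; rewrite -cFubini1//=.
under eq_cintegral => x _ do rewrite cintegralZl// mulrC.
by rewrite cintegralZl// mulrC.
Qed.

End ComplexFubini.

(** * Series of complex numbers and of complex-valued functions *)

Section ComplexSeries.
Context {R : realType}.
Implicit Types (u : nat -> R[i]) (c : R[i]) (r v : nat -> R).

Lemma csummableE u :
  csummable u <-> (\sum_(0 <= n <oo) (normc (u n))%:E < +oo)%E.
Proof.
rewrite /csummable /summable nneseries_esumT => [|n]; last first.
  by rewrite lee_fin normc_ge0.
by under eq_esum do rewrite gee0_abs ?lee_fin ?normc_ge0//.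
Qed.

Lemma dominated_series_cvg r v : (forall n, `|r n| <= v n) ->
  (\sum_(0 <= n <oo) (v n)%:E < +oo)%E -> cvgn (series r).
Proof.
move=> rv voo; have v0 n : 0 <= v n by rewrite (le_trans _ (rv n)).
have fv : (\sum_(0 <= n <oo) (v n)%:E)%E \is a fin_num.
  by rewrite ge0_fin_numE// nneseries_ge0// => n _ _; rewrite lee_fin.
apply: normed_cvg; apply: nondecreasing_is_cvgn.
  by apply/nondecreasing_seqP => n; rewrite [leRHS]seriesSr lerDl /=.
exists (fine (\sum_(0 <= n <oo) (v n)%:E)%E) => _ [N _ <-].
rewrite -lee_fin fineK// /series/= -sumEFin.
apply: (@le_trans _ _ (\sum_(0 <= n < N) (v n)%:E)%E).
  by apply: lee_sum => n _; rewrite lee_fin.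
by apply: nneseries_lim_ge => n _ _; rewrite lee_fin.
Qed.

Lemma lim_series_le r v : (forall n, `|r n| <= v n) -> cvgn (series r) ->
  ((limn (series r))%:E <= \sum_(0 <= n <oo) (v n)%:E)%E.
Proof.
move=> rv cr; have v0 n : 0 <= v n by rewrite (le_trans _ (rv n)).
rewrite -EFin_lim//; apply: lime_le.
  by apply/cvg_ex; exists (limn (series r))%:E; apply: cvg_EFin => //; exact: nearW.
apply: nearW => N /=; rewrite /series/= -sumEFin.
apply: (@le_trans _ _ (\sum_(0 <= n < N) (v n)%:E)%E).
  by apply: lee_sum => n _; rewrite lee_fin (le_trans (ler_norm _)).
by apply: nneseries_lim_ge => n _ _; rewrite lee_fin.
Qed.

Lemma csummable_cvg u : csummable u ->
  cvgn (series (fun n => Re (u n))) /\ cvgn (series (fun n => Im (u n))).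
Proof.
move/csummableE => uoo.
split; apply: dominated_series_cvg uoo => n; first exact: Re_le_normc.
exact: Im_le_normc.
Qed.

Lemma csummableZ c u : csummable u -> csummable (fun n => c * u n).
Proof.
move/csummableE => uoo; apply/csummableE.
under eq_eseriesr do rewrite Normc.normcM EFinM.
rewrite nneseriesZl => [|n _]; last by rewrite lee_fin normc_ge0.
by rewrite lte_mul_pinfty// lee_fin normc_ge0.
Qed.

Lemma cseriesZ c u : csummable u ->
  cseries (fun n => c * u n) = c * cseries u.
Proof.
move=> su; have [cr ci] := csummable_cvg su.
apply: complex_ext; rewrite ?ReM ?ImM /=; apply/cvg_lim => //.
  rewrite (_ : series _ = (fun N => Re c * series (fun n => Re (u n)) N -
      Im c * series (fun n => Im (u n)) N)).
    by apply: cvgB; apply: cvgMr.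
  apply/funext => N; rewrite /series/= !mulr_sumr -sumrB.
  by apply: eq_bigr => n _; rewrite ReM.
rewrite (_ : series _ = (fun N => Re c * series (fun n => Im (u n)) N +
      Im c * series (fun n => Re (u n)) N)).
  by apply: cvgD; apply: cvgMr.
apply/funext => N; rewrite /series/= !mulr_sumr -big_split/=.
by apply: eq_bigr => n _; rewrite ImM.
Qed.

Lemma normc_cseries_le u : csummable u ->
  ((normc (cseries u))%:E <= \sum_(0 <= n <oo) (normc (u n))%:E)%E.
Proof.
move=> su; have [c c1 cE] := normc_rotate (cseries u).
rewrite -[normc _]/(Re (normc _)%:C) -cE -cseriesZ//=.
have [cr _] := csummable_cvg (csummableZ c su).
apply: lim_series_le cr => n.
by rewrite (le_trans (Re_le_normc _))// Normc.normcM c1 mul1r.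
Qed.

End ComplexSeries.

Section SeriesIntegral.
Context {d} {T : measurableType d} {R : realType}.
Variables (mu : {measure set T -> \bar R}) (D : set T).
Hypothesis mD : measurable D.

Let real_integral_series (r v : nat -> T -> R) :
  (forall n, measurable_fun D (r n)) -> (forall n, measurable_fun D (v n)) ->
  (forall n x, `|r n x| <= v n x) ->
  (forall x, D x -> cvgn (series (r ^~ x))) ->
  (\sum_(0 <= n <oo) \int[mu]_(x in D) (v n x)%:E < +oo)%E ->
  mu.-integrable D (fun x => (limn (series (r ^~ x)))%:E) /\
  Rintegral mu D (fun x => limn (series (r ^~ x))) =
    limn (series (fun n => Rintegral mu D (r n))).
Proof.
move=> mr mv rv cr voo.
have v0 n x : 0 <= v n x by rewrite (le_trans _ (rv n x)).
pose g x := (\sum_(0 <= n <oo) (v n x)%:E)%E.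
have mg : measurable_fun D g.
  apply: ge0_emeasurable_sum => [n x _ _|n _]; first by rewrite lee_fin.
  exact/measurable_EFinP.
have g0 x : (0 <= g x)%E by apply: nneseries_ge0 => n _ _; rewrite lee_fin.
have ig : mu.-integrable D g.
  apply/integrableP; split=> //; under eq_integral do rewrite gee0_abs//.
  rewrite /g integral_nneseries// => [n|n x _]; last by rewrite lee_fin.
  exact/measurable_EFinP.
have ir n : mu.-integrable D (EFin \o r n).
  apply: (le_integrable mD _ _ ig); first exact/measurable_EFinP.
  move=> x _; rewrite (gee0_abs (g0 x)) /=.
  apply: (@le_trans _ _ (v n x)%:E); first by rewrite lee_fin.
  apply: (@le_trans _ _ (\sum_(0 <= k < n.+1) (v k x)%:E)%E).
    rewrite big_nat_recr//= leeDr// sume_ge0// => k _; by rewrite lee_fin.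
  by apply: nneseries_lim_ge => k _ _; rewrite lee_fin.
pose F N x := (series (r ^~ x) N)%:E.
have mF N : measurable_fun D (F N).
  by apply/measurable_EFinP; rewrite /series; apply: measurable_sum.
have cF x : D x -> F ^~ x @ \oo --> (limn (series (r ^~ x)))%:E.
  by move=> Dx; apply: cvg_EFin; [exact: nearW|exact: cr].
have mlim : measurable_fun D (fun x => (limn (series (r ^~ x)))%:E).
  exact: emeasurable_fun_cvg cF.
have Fg N x : (`|F N x| <= g x)%E.
  apply: (@le_trans _ _ (\sum_(0 <= n < N) (v n x)%:E)%E).
    rewrite /F /series/= sumEFin lee_fin (le_trans (ler_norm_sum _ _ _))//.
    exact: ler_sum.
  by apply: nneseries_lim_ge => n _ _; rewrite lee_fin.
have [il _ lim] := dominated_convergence mD mF mlim (aeW _ cF) ig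
  (aeW _ (fun x n (_ : D x) => Fg n x)).
split=> //; apply/esym/cvg_lim => //.
have E N : (\int[mu]_(x in D) F N x)%E =
    (series (fun n => Rintegral mu D (r n)) N)%:E.
  rewrite /F /series/= -sumEFin.
  under eq_integral do rewrite -sumEFin.
  rewrite integral_sum//; apply: eq_bigr => n _.
  by rewrite /Rintegral fineK//; exact: integrable_fin_num (ir n).
have El : (\int[mu]_(x in D) (limn (series (r ^~ x)))%:E =
    (Rintegral mu D (fun x => limn (series (r ^~ x))))%:E)%E.
  by rewrite fineK//; exact: integrable_fin_num il.
by move: lim; rewrite El; under eq_fun do rewrite E; move/fine_cvg.
Qed.

(** Both series of real and imaginary parts are dominated by the series of
    moduli, whose sum is integrable, so dominated convergence applies. *)
Lemma cintegral_cseries (f_ : nat -> T -> R[i]) :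
  (forall n, cintegrable mu D (f_ n)) ->
  (forall x, D x -> csummable (f_ ^~ x)) ->
  (\sum_(0 <= n <oo) \int[mu]_(x in D) (normc (f_ n x))%:E < +oo)%E ->
  [/\ cintegrable mu D (fun x => cseries (f_ ^~ x)),
      cintegral mu D (fun x => cseries (f_ ^~ x)) =
        cseries (fun n => cintegral mu D (f_ n)) &
      (\int[mu]_(x in D) (normc (cseries (f_ ^~ x)))%:E <=
        \sum_(0 <= n <oo) \int[mu]_(x in D) (normc (f_ n x))%:E)%E].
Proof.
move=> fi fs foo.
have mf n := ((cintegrableP mu (f_ n) mD).1 (fi n)).1.
have mn n : measurable_fun D (fun x => normc (f_ n x)).
  exact: cmeasurable_normc.
have [ir er] := real_integral_series (fun n => (mf n).1) mn
  (fun n x => Re_le_normc _) (fun x Dx => (csummable_cvg (fs x Dx)).1) foo.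
have [ii ei] := real_integral_series (fun n => (mf n).2) mn
  (fun n x => Im_le_normc _) (fun x Dx => (csummable_cvg (fs x Dx)).2) foo.
have icf : cintegrable mu D (fun x => cseries (f_ ^~ x)) by split.
split=> //; first by apply: complex_ext.
have mcf := ((cintegrableP mu _ mD).1 icf).1.
rewrite -integral_nneseries//; last 2 first.
- by move=> n; exact/measurable_EFinP.
- by move=> n x _; rewrite lee_fin normc_ge0.
apply: ge0_le_integral => //.
- by move=> x _; rewrite lee_fin normc_ge0.
- by apply/measurable_EFinP; exact: cmeasurable_normc.
- apply: ge0_emeasurable_sum => [n x _ _|n _]; first by rewrite lee_fin normc_ge0.
  exact/measurable_EFinP.
- by move=> x Dx; exact/normc_cseries_le/fs.
Qed.

End SeriesIntegral.

(** * Affine change of variable for Lebesgue measure *)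

Section AffineChange.
Context {R : realType}.
Local Notation mu := (@lebesgue_measure R).
Local Notation TR := (measurableTypeR R).
Variables (c e : R).
Hypothesis c_gt0 : 0 < c.

Let phi (x : TR) : TR := c * x + e.

Let mphi : measurable_fun setT phi.
Proof. by apply: measurable_funD => //; apply: measurable_funM. Qed.

Let c_nng : {nonneg R} := NngNum (ltW c_gt0).

(** Uniqueness of Lebesgue measure reduces this to half-open intervals. *)
Let lebesgue_affine (A : set TR) : measurable A ->
  mu A = (c%:E * mu (phi @^-1` A))%E.
Proof.
pose push := measure_function_pushforward__canonical__measure_function_Measure mu mphi.
pose nu := mscale c_nng push.
move=> mA; rewrite (@lebesgue_measure_unique R nu)//.
move=> X [[a b] _ <-]; rewrite /nu /= /mscale/= /pushforward.
have -> : phi @^-1` `]a, b]%classic = `](a - e) / c, (b - e) / c]%classic.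
  apply/seteqP; split=> x /=; rewrite !in_itv/= /phi ltr_pdivrMr// ler_pdivlMr//;
    by move=> /andP[h1 h2]; apply/andP; split; lra.
rewrite !lebesgue_measure_itv/= !lte_fin ltr_pM2r ?invr_gt0// ltrD2r.
case: ifPn => _; last by rewrite mule0.
by rewrite -!EFinB -EFinM -mulrBl opprB addrA subrK mulrCA divff ?mulr1// gt_eqF.
Qed.

Let push :=
  measure_function_pushforward__canonical__measure_function_Measure mu mphi.

Lemma ge0_integral_affine (f : TR -> \bar R) :
  measurable_fun setT f -> (forall x, (0 <= f x)%E) ->
  (\int[mu]_x f x = c%:E * \int[mu]_x f (c * x + e)%R)%E.
Proof.
move=> mf f0.
rewrite (@eq_measure_integral _ _ _ setT (mscale c_nng push)).
  rewrite ge0_integral_mscale//=; congr (_ * _)%E.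
  by rewrite (ge0_integral_pushforward mphi mu).
by move=> A mA _; exact: lebesgue_affine.
Qed.

Let integrable_affine (f : TR -> \bar R) :
  mu.-integrable setT f -> mu.-integrable setT (f \o phi).
Proof.
move=> /integrableP[mf foo]; apply/integrableP; split.
  exact: measurableT_comp.
move: foo; rewrite ge0_integral_affine//; last exact: measurableT_comp.
rewrite muleC -lte_pdivlMr// => foo.
by apply: lt_le_trans foo _; rewrite leey.
Qed.

Let Rintegral_affine (f : TR -> R) : mu.-integrable setT (EFin \o f) ->
  Rintegral mu setT f = c * Rintegral mu setT (f \o phi).
Proof.
move=> fi; have gi := integrable_affine fi.
have mf := measurable_int _ fi.
have Ep : (\int[mu]_x (EFin \o f)^\+ x =
    c%:E * \int[mu]_x (EFin \o (f \o phi))^\+ x)%E.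
  rewrite ge0_integral_affine => [|| x]; last exact: funepos_ge0.
    by congr (_ * _)%E; apply: eq_integral => x _; rewrite !funeposE.
  exact: measurable_funepos.
have En : (\int[mu]_x (EFin \o f)^\- x =
    c%:E * \int[mu]_x (EFin \o (f \o phi))^\- x)%E.
  rewrite ge0_integral_affine => [|| x]; last exact: funeneg_ge0.
    by congr (_ * _)%E; apply: eq_integral => x _; rewrite !funenegE.
  exact: measurable_funeneg.
have fp : (\int[mu]_x (EFin \o (f \o phi))^\+ x)%E \is a fin_num.
  by apply: integrable_pos_fin_num => //; exact: gi.
have fn : (\int[mu]_x (EFin \o (f \o phi))^\- x)%E \is a fin_num.
  by apply: integrable_neg_fin_num => //; exact: gi.
rewrite /Rintegral integralE Ep En -muleBr//; last by rewrite fin_num_adde_defr.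
by rewrite -integralE fineM//; exact: integrable_fin_num gi.
Qed.

Lemma cintegral_affine (f : TR -> R[i]) : cintegrable mu setT f ->
  cintegrable mu setT (fun x => f (c * x + e)) /\
  cintegral mu setT f = c%:C * cintegral mu setT (fun x => f (c * x + e)).
Proof.
move=> [fr fi]; split.
  by split; [exact: (integrable_affine fr)|exact: (integrable_affine fi)].
apply: complex_ext; rewrite ?ReM ?ImM /= ?mul0r ?subr0 ?addr0.
  exact: Rintegral_affine fr.
exact: Rintegral_affine fi.
Qed.

End AffineChange.

(** * Complex powers of positive reals *)

Section ComplexPower.
Context {R : realType}.
Implicit Types (t s : R) (z w k : R[i]).

Lemma Re_cpow t z : Re (cpow t z) = expR (Re z * ln t) * cos (Im z * ln t).
Proof. by rewrite /cpow /cexp /= ReM ImM /= !mulr0 subr0 add0r. Qed.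

Lemma Im_cpow t z : Im (cpow t z) = expR (Re z * ln t) * sin (Im z * ln t).
Proof. by rewrite /cpow /cexp /= ReM ImM /= !mulr0 subr0 add0r. Qed.

Lemma cexpD z w : cexp (z + w) = cexp z * cexp w.
Proof.
apply: complex_ext; rewrite ?ReM ?ImM /= ReD ImD expRD ?cosD ?sinD; ring.
Qed.

Lemma cpowD t z w : cpow t (z + w) = cpow t z * cpow t w.
Proof. by rewrite /cpow mulrDl cexpD. Qed.

Lemma cpowM s t z : 0 < s -> 0 < t -> cpow (s * t) z = cpow s z * cpow t z.
Proof.
by move=> s0 t0; rewrite /cpow lnM ?posrE// rmorphD mulrDr cexpD.
Qed.

Lemma cpow_realE t (r : R) : cpow t r%:C = (expR (r * ln t))%:C.
Proof.
by apply: complex_ext; rewrite ?Re_cpow ?Im_cpow/= mul0r ?cos0 ?sin0 ?mulr1 ?mulr0.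
Qed.

Lemma cpow_powR t (r : R) : 0 < t -> cpow t r%:C = (t `^ r)%:C.
Proof. by move=> t0; rewrite cpow_realE /powR gt_eqF. Qed.

Lemma cpow0 t : cpow t 0 = 1.
Proof. by rewrite (cpow_realE t 0) mul0r expR0. Qed.

Lemma cpow1 t : 0 < t -> cpow t 1 = t%:C.
Proof. by move=> t0; rewrite (cpow_realE t 1) mul1r lnK. Qed.

Lemma cpow_one z : cpow 1 z = 1.
Proof. by rewrite /cpow ln1 mulr0 -[RHS](cpow0 1) /cpow mul0r. Qed.

Lemma normc_cpow t z : normc (cpow t z) = expR (Re z * ln t).
Proof.
rewrite normcE Re_cpow Im_cpow !exprMn -mulrDr cos2Dsin2 mulr1.
by rewrite sqrtr_sqr ger0_norm ?expR_ge0.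
Qed.

Lemma normc_cpow_realE t z : (normc (cpow t z))%:C = cpow t (Re z)%:C.
Proof. by rewrite normc_cpow cpow_realE. Qed.

Lemma cpowB1 t z : 0 < t -> cpow t (z - 1) = cpow t z * (t^-1)%:C.
Proof.
move=> t0; rewrite -{2}(subrK 1 z) (cpowD t (z - 1)) cpow1// -mulrA -rmorphM.
by rewrite divff ?gt_eqF// rmorph1 mulr1.
Qed.

Lemma cmeasurable_cpow z : cmeasurable setT (fun t : R => cpow t z).
Proof.
have ml (r : R) : measurable_fun setT (fun t : R => r * ln t).
  exact: measurable_funM.
have mc : measurable_fun setT (@cos R).
  by apply: continuous_measurable_fun; exact: continuous_cos.
have ms : measurable_fun setT (@sin R).
  by apply: continuous_measurable_fun; exact: continuous_sin.
split; [under eq_fun do rewrite Re_cpow|under eq_fun do rewrite Im_cpow];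
  by apply: measurable_funM; apply: measurableT_comp.
Qed.

Lemma is_derive_cpow t k z : 0 < t ->
  is_derive t 1 (fun t => Re (k * cpow t z)) (Re (k * (z * cpow t (z - 1)))).
Proof.
move=> t0.
have dl (r : R) : is_derive t 1 (fun t => r * ln t) (r * t^-1).
  by have := is_deriveZ r (is_derive1_ln t0).
have de := is_derive1_comp (is_derive_expR _) (dl (Re z)).
have dc := is_derive1_comp (is_derive_cos _) (dl (Im z)).
have ds := is_derive1_comp (is_derive_sin _) (dl (Im z)).
have := is_deriveM de (is_deriveB (is_deriveZ (Re k) dc) (is_deriveZ (Im k) ds)).
rewrite (_ : (_ * _) = (fun t => Re (k * cpow t z))); last first.
  apply/funext => x; rewrite /= ReM Re_cpow Im_cpow /=.
  rewrite !fctE /GRing.scale_fun /GRing.scale /=; ring.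
move=> H; apply: (is_derive_eq H).
rewrite cpowB1// !(ReM, ImM) Re_cpow Im_cpow /= !fctE.
by rewrite /GRing.scale_fun /GRing.scale /=; ring.
Qed.

(** The factor k gives access to both parts of the complex integral: k = 1 is the
    real part and k = -i the imaginary part. *)
Lemma integral_cpow t k z : 0 < t -> t < 1 ->
  (\int[@lebesgue_measure R]_(x in `[t, 1%R]) (Re (k * (z * cpow x (z - 1))))%:E =
  (Re (k * (1 - cpow t z)))%:E)%E.
Proof.
move=> t0 t1.
have gt0 (x : R) : x \in `[t, 1] -> 0 < x.
  by rewrite in_itv/= => /andP[tx _]; exact: lt_le_trans tx.
have cont (y : R) w : 0 < y -> {for y, continuous (fun x => Re (w * cpow x z))}.
  move=> y0; apply: differentiable_continuous; apply/derivable1_diffP.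
  exact: (@ex_derive _ _ _ _ _ _ _ (is_derive_cpow w z y0)).
rewrite (@continuous_FTC2 _ _ (fun x => Re (k * cpow x z)))//.
- by rewrite -EFinB -ReB -mulrBr cpow_one.
- have -> : (fun x => Re (k * (z * cpow x (z - 1)))) =
      (fun x => Re ((k * z) * cpow x (z - 1))).
    by apply/funext => x; rewrite mulrA.
  apply: derivable_within_continuous => x xi.
  exact: (@ex_derive _ _ _ _ _ _ _ (is_derive_cpow (k * z) (z - 1) (gt0 x xi))).
- split=> [x /subset_itv_oo_cc xi||].
  + exact: (@ex_derive _ _ _ _ _ _ _ (is_derive_cpow k z (gt0 x xi))).
  + by apply: cvg_at_right_filter; exact: cont.
  + by apply: cvg_at_left_filter; exact: cont.
- move=> x /subset_itv_oo_cc xi; rewrite derive1E.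
  exact: (@derive_val _ _ _ _ _ _ _ (is_derive_cpow k z (gt0 x xi))).
Qed.

End ComplexPower.

(** * The kernels of Euler's integrals *)

Section EulerKernels.
Context {R : realType}.
Local Notation mu := (@lebesgue_measure R).
Local Notation TR := (measurableTypeR R).
Implicit Types (t s : R) (a b z w : R[i]).

(** Extending the kernels by zero to the whole line leaves no domains to track
    under translations and dilations. *)
Definition gamma_kernel a : TR -> R[i] :=
  czero_ext `]0, +oo[%classic (fun t => cpow t (a - 1) * (expR (- t))%:C).

Definition beta_kernel a b : TR -> R[i] :=
  czero_ext `]0, 1[%classic (fun u => cpow u (a - 1) * cpow (1 - u) (b - 1)).

Definition Beta a b : R[i] := cintegral mu setT (beta_kernel a b).

Lemma gamma_kernelE a t : 0 < t ->
  gamma_kernel a t = cpow t (a - 1) * (expR (- t))%:C.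
Proof. by move=> t0; rewrite /gamma_kernel /czero_ext mem_set//= in_itv/= t0. Qed.

Lemma gamma_kernel0 a t : t <= 0 -> gamma_kernel a t = 0.
Proof.
move=> t0; rewrite /gamma_kernel /czero_ext memNset//= in_itv/= andbT.
by apply/negP; rewrite -leNgt.
Qed.

Lemma beta_kernelE a b t : 0 < t < 1 ->
  beta_kernel a b t = cpow t (a - 1) * cpow (1 - t) (b - 1).
Proof. by move=> t0; rewrite /beta_kernel /czero_ext mem_set//= in_itv/= t0. Qed.

Lemma beta_kernel0 a b t : ~~ (0 < t < 1) -> beta_kernel a b t = 0.
Proof.
by move=> t0; rewrite /beta_kernel /czero_ext memNset//= in_itv/= (negbTE t0).
Qed.

Lemma Gamma_integralE a : Gamma_integral a = cintegral mu setT (gamma_kernel a).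
Proof. by rewrite /Gamma_integral cintegral_mkcond. Qed.

Lemma cmeasurable_gamma_kernel a : cmeasurable setT (gamma_kernel a).
Proof.
have [mr mi] := @cmeasurable_cpow R (a - 1).
apply: (cmeasurable_restrict _ _).1 => //; apply: cmeasurableM.
  by split; exact: measurable_funTS.
apply: cmeasurable_real; apply: measurableT_comp => //.
Qed.

Lemma cmeasurable_beta_kernel a b : cmeasurable setT (beta_kernel a b).
Proof.
have [mr mi] := @cmeasurable_cpow R (a - 1).
have cb := @cmeasurable_cpow R (b - 1).
have m1 : measurable_fun setT (fun u : TR => (1 - u : TR)).
  by apply: measurable_funB.
have [mr' mi'] := cmeasurable_comp cb m1.
apply: (cmeasurable_restrict _ _).1 => //; apply: cmeasurableM.
  by split; exact: measurable_funTS.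
by split; exact: measurable_funTS.
Qed.

Lemma normc_gamma_kernel a t :
  (normc (gamma_kernel a t))%:C = gamma_kernel (Re a)%:C t.
Proof.
have [t0|t0] := leP t 0; first by rewrite !gamma_kernel0// Normc.normc0.
rewrite !gamma_kernelE// Normc.normcM normc_real rmorphM /= normc_cpow_realE ReB.
by rewrite ger0_norm ?expR_ge0// rmorphB.
Qed.

Lemma normc_beta_kernel a b t :
  (normc (beta_kernel a b t))%:C = beta_kernel (Re a)%:C (Re b)%:C t.
Proof.
case: (boolP (0 < t < 1)) => t01; last by rewrite !beta_kernel0// Normc.normc0.
by rewrite !beta_kernelE// Normc.normcM rmorphM /= !normc_cpow_realE !ReB !rmorphB.
Qed.

(** The convolution of two Gamma kernels is a Gamma kernel times a rescaled
    Beta kernel; this is Euler's evaluation of the Beta integral before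
    integration. *)
Lemma gamma_kernel_convolution a b s t :
  gamma_kernel a s * gamma_kernel b (t - s) =
  gamma_kernel (a + b) t * ((t^-1)%:C * beta_kernel a b (t^-1 * s)).
Proof.
have [t0|t0] := leP t 0.
  rewrite [gamma_kernel (a + b) t]gamma_kernel0// mul0r.
  have [s0|s0] := leP s 0; first by rewrite gamma_kernel0// mul0r.
  by rewrite [gamma_kernel b _]gamma_kernel0 ?mulr0//; lra.
have ti0 : 0 < t^-1 by rewrite invr_gt0.
case: (boolP (0 < t^-1 * s < 1)) => [u01|].
  have [s0 st] : 0 < s /\ s < t.
    have /andP[] := u01; rewrite pmulr_rgt0// mulrC ltr_pdivrMr// mul1r.
    by move=> ? ?.
  have d0 : 0 < t - s by rewrite subr_gt0.
  rewrite (beta_kernelE _ _ u01) !gamma_kernelE//.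
  have -> : 1 - t^-1 * s = t^-1 * (t - s) by rewrite mulrBr mulVf// gt_eqF.
  have E1 : expR (- t) = expR (- s) * expR (- (t - s)).
    by rewrite -expRD; congr expR; ring.
  have cti z : cpow t^-1 z = (cpow t z)^-1.
    have h : cpow t^-1 z * cpow t z = 1.
      by rewrite -cpowM// mulVf ?gt_eqF// cpow_one.
    have n0 : cpow t z != 0.
      by apply/eqP => e; move: h; rewrite e mulr0 => /eqP; rewrite eq_sym oner_eq0.
    by apply: (mulIf n0); rewrite h mulVf.
  have n0 z : cpow t z != 0 by rewrite -normc_gt0 normc_cpow expR_gt0.
  rewrite E1 !cpowM// rmorphM !cti.
  have -> : a + b - 1 = (a - 1) + (b - 1) + 1 by ring.
  rewrite !(cpowD t) cpow1// fmorphV /=.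
  have tC : t%:C != 0 by rewrite eq_complex /= gt_eqF.
  field. by rewrite !n0.
rewrite negb_and -!leNgt => h.
rewrite beta_kernel0; last by rewrite negb_and -!leNgt.
rewrite !mulr0; case/orP: h => h.
  by rewrite [gamma_kernel a _]gamma_kernel0 ?mul0r// -(pmulr_rle0 _ ti0).
rewrite [gamma_kernel b _]gamma_kernel0 ?mulr0//.
by move: h; rewrite mulrC ler_pdivlMr// mul1r subr_le0.
Qed.

End EulerKernels.

(** * Absolute convergence of Euler's second integral *)

Section GammaIntegrable.
Context {R : realType}.
Local Notation mu := (@lebesgue_measure R).
Local Notation TR := (measurableTypeR R).

Let measurable_expRln (r : R) :
  measurable_fun setT (fun t : TR => expR (r * ln t)).
Proof.
by apply: measurableT_comp => //; exact: measurable_funM.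
Qed.

(** Each integral over [1/(n+2), 1] is at most 1/r by the fundamental theorem of
   calculus, and these intervals exhaust ]0, 1]. *)
Let integral_pow_near0 (r : R) : 0 < r ->
  (\int[mu]_(t in `]0%R, 1%R[) (expR ((r - 1) * ln t))%:E <= (r^-1)%:E)%E.
Proof.
move=> r0.
pose F (n : nat) : set TR := `[n.+2%:R^-1, 1]%classic.
pose f (t : TR) : \bar R := (expR ((r - 1) * ln t))%:E.
have mf D : measurable_fun D f.
  by apply/measurable_EFinP; apply: measurable_funTS.
have f0 t : (0 <= f t)%E by rewrite lee_fin expR_ge0.
have mF n : measurable (F n) by exact: measurable_itv.
have ndF : nondecreasing_seq F.
  move=> m n mn; rewrite subsetEset => t; rewrite /F /= !in_itv/= => /andP[h ->].
  rewrite andbT (le_trans _ h)// lef_pV2 ?posrE// ler_nat.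
  by rewrite !ltnS.
have IF n : (\int[mu]_(t in F n) f t <= (r^-1)%:E)%E.
  have e0 : (0 : R) < n.+2%:R^-1 by rewrite invr_gt0.
  have e1 : n.+2%:R^-1 < 1 :> R by rewrite invf_lt1// ltr1n.
  have E t : Re ((r^-1)%:C * (r%:C * cpow t (r%:C - 1))) = expR ((r - 1) * ln t).
    rewrite mulrA -rmorphM mulVf ?gt_eqF// rmorph1 mul1r.
    by rewrite -[1]/((1 : R)%:C) -rmorphB cpow_realE.
  have := integral_cpow (r^-1)%:C r%:C e0 e1.
  under eq_integral do rewrite E.
  move=> ->; rewrite cpow_realE -[1]/((1 : R)%:C) -rmorphB -rmorphM /= lee_fin.
  by rewrite ler_piMr ?invr_ge0 ?gerBl ?expR_ge0 ?ltW.
have lim := @ge0_nondecreasing_set_cvg_integral _ _ _ F f mu ndF mF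
  (fun n => mf (F n)) (fun n t _ => f0 t).
apply: (@le_trans _ _ (\int[mu]_(t in \bigcup_n F n) f t)%E).
  apply: ge0_subset_integral => //; first exact: bigcup_measurable.
  move=> t /=; rewrite in_itv/= => /andP[t0 t1].
  exists (Num.truncn t^-1) => //; rewrite /F /= in_itv/= (ltW t1) andbT.
  rewrite invf_ple ?posrE//; apply: ltW; rewrite (lt_trans (truncnS_gt _))//.
  by rewrite ltr_nat.
rewrite -(cvg_lim _ lim)//; apply: lime_le.
  by apply/cvg_ex; exists (\int[mu]_(t in \bigcup_n F n) f t)%E.
exact: nearW.
Qed.

(** Concavity gives ln t <= ln k + t / k - 1, and k = 2 |r - 1| + 1 is large enough
   for the linear term to absorb only half of the exponential decay. *)
Let gamma_tail (r t : R) : 1 <= t ->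
  (r - 1) * ln t - t <= `|r - 1| * ln (2 * `|r - 1| + 1) - t / 2.
Proof.
move=> t1; set q := `|r - 1|; set k := 2 * q + 1.
have q0 : 0 <= q by exact: normr_ge0.
have k0 : 0 < k by rewrite /k; lra.
have t0 : 0 < t by lra.
have l0 : 0 <= ln t by rewrite ln_ge0.
have h1 : (r - 1) * ln t <= q * ln t by rewrite ler_wpM2r// ler_norm.
have h2 : ln t <= ln k + t / k.
  have : ln (1 + (t / k - 1)) <= t / k - 1.
    by apply: le_ln1Dx; rewrite ltrBrDl subrr divr_gt0.
  have -> : 1 + (t / k - 1) = t / k by ring.
  rewrite ln_div ?posrE//; lra.
have h3 : q * ln t <= q * ln k + q * (t / k) by rewrite -mulrDr ler_wpM2l.
have h4 : q * (t / k) <= t / 2.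
  rewrite mulrCA ler_wpM2l// ?(ltW t0)// ler_pdivrMr// /k; lra.
lra.
Qed.

(** The kernel is dominated by t^(Re a - 1) on the unit interval and by a multiple
    of the density of an exponential law beyond it. *)
Lemma cintegrable_gamma_kernel (a : R[i]) : 0 < Re a ->
  cintegrable mu setT (gamma_kernel a).
Proof.
move=> a0; apply/cintegrableP => //; split; first exact: cmeasurable_gamma_kernel.
set r := Re a.
pose p : TR -> R := (fun t => expR ((r - 1) * ln t)) \_ `]0, 1[%classic.
pose C : R := 2 * expR (`|r - 1| * ln (2 * `|r - 1| + 1)).
have C0 : 0 <= C by rewrite mulr_ge0// expR_ge0.
have mp : measurable_fun setT (EFin \o p).
  apply/measurable_EFinP; apply: (measurable_restrictT _ (measurable_itv _)).1.
  exact: measurable_funTS (measurable_expRln _).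
have p0 t : 0 <= p t by rewrite /p patchE; case: ifP => // _; exact: expR_ge0.
have mE : measurable_fun setT (EFin \o exponential_pdf (2^-1 : R)).
  by apply/measurable_EFinP; exact: measurable_exponential_pdf.
have e0 t : 0 <= exponential_pdf (2^-1 : R) t by apply: exponential_pdf_ge0; lra.
apply: (@le_lt_trans _ _
    (\int[mu]_t ((p t)%:E + C%:E * (exponential_pdf 2^-1 t)%:E))%E).
  apply: ge0_le_integral => //.
  - by move=> t _; rewrite lee_fin normc_ge0.
  - apply/measurable_EFinP; apply: cmeasurable_normc.
    exact: cmeasurable_gamma_kernel.
  - by apply: emeasurable_funD => //; apply: measurable_funeM.
  - move=> t _; rewrite -EFinM -EFinD lee_fin.
    have [t0|t0] := leP t 0.
      by rewrite gamma_kernel0// Normc.normc0 addr_ge0// mulr_ge0.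
    rewrite gamma_kernelE// Normc.normcM normc_cpow normc_real.
    rewrite ger0_norm ?expR_ge0// ReB -/r /=.
    have [t1|t1] := ltP t 1.
      rewrite /p patchE mem_set/=; last by rewrite in_itv/= t0.
      rewrite -[leLHS]addr0 lerD ?mulr_ge0//.
      by rewrite ler_piMr ?expR_ge0// -expR0 ler_expR; lra.
    have -> : C * exponential_pdf 2^-1 t =
        expR (`|r - 1| * ln (2 * `|r - 1| + 1) - t / 2).
      rewrite exponential_pdfE ?ltW// /C expRD mulrACA mulfV// mul1r.
      by congr (_ * expR _); rewrite mulNr mulrC.
    rewrite -[leLHS]add0r lerD// -expRD ler_expR.
    have := gamma_tail r t1; lra.
rewrite ge0_integralD//.
- have -> : (\int[mu]_t (C%:E * (exponential_pdf 2^-1 t)%:E) = C%:E)%E.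
    rewrite ge0_integralZl//.
      by rewrite integral_exponential_pdf ?mule1//; lra.
    by move=> t _; rewrite lee_fin.
  rewrite lte_add_pinfty ?ltry//.
  apply: le_lt_trans (ltry r^-1); apply: le_trans (integral_pow_near0 a0).
  rewrite [leRHS]integral_mkcond le_eqVlt; apply/orP; left; apply/eqP.
  by apply: eq_integral => t _; rewrite /p !patchE; case: ifP.
- by move=> t _; rewrite lee_fin.
- by move=> t _; rewrite mule_ge0// lee_fin.
- exact: measurable_funeM.
Qed.

(** On the interval [1, 2], where 0 <= ln t <= 1, the kernel is bounded below. *)
Lemma normc_gamma_kernel_gt0 (a : R[i]) : 0 < Re a ->
  (0 < \int[mu]_t (normc (gamma_kernel a t))%:E)%E.
Proof.
move=> a0; set r := Re a.
pose m := expR (- `|r - 1| - 2).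
apply: (@lt_le_trans _ _ (\int[mu]_(t in `[1%R, 2%R]) m%:E)%E).
  rewrite integral_cst; last exact: measurable_itv.
  rewrite /= lebesgue_measure_itv/= lte_fin ltr1n /=.
  by rewrite -EFinB -EFinM lte_fin mulr_gt0 ?expR_gt0//; lra.
apply: (@le_trans _ _
    (\int[mu]_(t in `[1%R, 2%R]) (normc (gamma_kernel a t))%:E)%E).
  apply: ge0_le_integral => //.
  - by move=> t _; rewrite lee_fin expR_ge0.
  - apply/measurable_EFinP; apply: measurable_funTS; apply: cmeasurable_normc.
    exact: cmeasurable_gamma_kernel.
  - move=> t /=; rewrite in_itv/= => /andP[t1 t2]; rewrite lee_fin.
    have t0 : 0 < t by lra.
    rewrite gamma_kernelE// Normc.normcM normc_cpow normc_real.
    rewrite ger0_norm ?expR_ge0//.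
    rewrite -expRD ler_expR ReB -/r /=.
    have l0 : 0 <= ln t by rewrite ln_ge0.
    have l1 : ln t <= 1.
      have : ln (1 + (t - 1)) <= t - 1 by apply: le_ln1Dx; lra.
      by rewrite addrC subrK; lra.
    have h : - `|r - 1| <= (r - 1) * ln t.
      rewrite lerNl -mulNr (le_trans (ler_norm _))// normrM normrN ler_piMr//.
      by rewrite ger0_norm.
    lra.
apply: ge0_subset_integral => //.
- apply/measurable_EFinP; apply: cmeasurable_normc.
  exact: cmeasurable_gamma_kernel.
- by move=> t _; rewrite lee_fin normc_ge0.
Qed.

End GammaIntegrable.

(** * Beta integral *)

Section BetaFormula.
Context {R : realType}.
Local Notation mu := (@lebesgue_measure R).
Local Notation TR := (measurableTypeR R).
Variables (a b : R[i]).
Hypotheses (a_gt0 : 0 < Re a) (b_gt0 : 0 < Re b).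

Let norm1 (f : TR -> R[i]) : \bar R := (\int[mu]_t (normc (f t))%:E)%E.

Let norm1_ge0 f : (0 <= norm1 f)%E.
Proof. by apply: integral_ge0 => t _; rewrite lee_fin normc_ge0. Qed.

Let norm1_affine (c e : R) (f : TR -> R[i]) : 0 < c -> cmeasurable setT f ->
  (norm1 f = c%:E * norm1 (fun x => f (c * x + e)%R))%E.
Proof.
move=> c0 mf.
apply: (@ge0_integral_affine R c e c0 (fun t => (normc (f t))%:E)).
  by apply/measurable_EFinP; exact: cmeasurable_normc.
by move=> x; rewrite lee_fin normc_ge0.
Qed.

Let norm1Z (c : R[i]) (f : TR -> R[i]) : cmeasurable setT f ->
  (norm1 (fun t => c * f t)%R = (normc c)%:E * norm1 f)%E.
Proof.
move=> mf; rewrite /norm1; under eq_integral do rewrite Normc.normcM EFinM.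
rewrite ge0_integralZl//.
- by apply/measurable_EFinP; exact: cmeasurable_normc.
- by move=> x _; rewrite lee_fin normc_ge0.
- by rewrite lee_fin normc_ge0.
Qed.

Let cmeasurable_affine (c e : R) (f : TR -> R[i]) : cmeasurable setT f ->
  cmeasurable setT (fun x : TR => f (c * x + e)).
Proof.
move=> mf; apply: (cmeasurable_comp mf).
by apply: measurable_funD => //; apply: measurable_funM.
Qed.

Let F (p : TR * TR) : R[i] := gamma_kernel a p.1 * gamma_kernel b (p.2 - p.1).

Let cmeasurable_F : cmeasurable setT F.
Proof.
apply: cmeasurableM; apply: cmeasurable_comp; try exact: cmeasurable_gamma_kernel.
  exact: measurable_fst.
by apply: measurable_funB; [exact: measurable_snd|exact: measurable_fst].
Qed.

Let measurable_normc_F : measurable_fun setT (fun p => (normc (F p))%:E).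
Proof. by apply/measurable_EFinP; exact: cmeasurable_normc. Qed.

Let measurable_normc_gamma (z : R[i]) :
  measurable_fun setT (fun t => (normc (gamma_kernel z t))%:E).
Proof.
apply/measurable_EFinP; apply: cmeasurable_normc.
exact: cmeasurable_gamma_kernel.
Qed.

Let norm1_gamma_lty z : 0 < Re z -> (norm1 (gamma_kernel z) < +oo)%E.
Proof.
move=> z0; have iz := cintegrable_gamma_kernel z0.
by have [] := (cintegrableP mu _ measurableT).1 iz.
Qed.

Let cintegrable_F : cintegrable (mu \x mu)%E setT F.
Proof.
apply/cintegrableP => //; split=> //.
rewrite fubini_tonelli1//; last by move=> p; rewrite lee_fin normc_ge0.
have E s : fubini_F mu (fun p => (normc (F p))%:E) s =
    (norm1 (gamma_kernel b) * (normc (gamma_kernel a s))%:E)%E.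
  rewrite /fubini_F -/(norm1 (fun t => F (s, t))).
  have -> : (fun t => F (s, t)) =
      (fun t => gamma_kernel a s * gamma_kernel b (1 * t + - s)).
    by apply/funext => t; rewrite /F /= mul1r.
  have mb := cmeasurable_gamma_kernel (R := R) b.
  rewrite norm1Z; last exact: cmeasurable_affine.
  by rewrite (@norm1_affine 1 (- s) (gamma_kernel b))// mul1e muleC.
under eq_integral do rewrite E.
rewrite ge0_integralZl//; last by move=> x _; rewrite lee_fin normc_ge0.
rewrite lte_mul_pinfty//; [|exact: norm1_gamma_lty].
by rewrite ge0_fin_numE//; exact: norm1_gamma_lty.
Qed.

Let FE s t : F (s, t) =
  gamma_kernel (a + b) t * ((t^-1)%:C * beta_kernel a b (t^-1 * s)).
Proof. exact: gamma_kernel_convolution. Qed.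

(** Integrating the modulus of the convolution in both orders shows that the
    product of the L1 norms of the Beta kernel and of a Gamma kernel is finite;
    the second factor is positive. *)
Lemma cintegrable_beta_kernel : cintegrable mu setT (beta_kernel a b).
Proof.
have mb := cmeasurable_beta_kernel a b.
have ab0 : 0 < Re (a + b) by rewrite ReD addr_gt0.
apply/cintegrableP => //; split=> //.
have [_] := (cintegrableP _ F measurableT).1 cintegrable_F.
rewrite fubini_tonelli2//; last by move=> p; rewrite lee_fin normc_ge0.
have E t : fubini_G mu (fun p => (normc (F p))%:E) t =
    (norm1 (beta_kernel a b) * (normc (gamma_kernel (a + b) t))%:E)%E.
  rewrite /fubini_G -/(norm1 (fun s => F (s, t))).
  have [t0|t0] := leP t 0.
    rewrite gamma_kernel0// Normc.normc0 mule0 /norm1.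
    under eq_integral do rewrite FE gamma_kernel0// mul0r Normc.normc0.
    exact: integral0.
  have ti0 : 0 < t^-1 by rewrite invr_gt0.
  have -> : (fun s => F (s, t)) = (fun s => gamma_kernel (a + b) t * (t^-1)%:C *
      beta_kernel a b (t^-1 * s + 0)).
    by apply/funext => s; rewrite FE mulrA addr0.
  rewrite norm1Z; last exact: cmeasurable_affine.
  rewrite (@norm1_affine t^-1 0 (beta_kernel a b))//.
  by rewrite Normc.normcM normc_real gtr0_norm// EFinM -muleA muleC.
under [X in (X < _)%E -> _]eq_integral do rewrite E.
rewrite ge0_integralZl//; last by move=> x _; rewrite lee_fin normc_ge0.
rewrite -/(norm1 (beta_kernel a b)).
apply: contraTT; rewrite -!leNgt !leye_eq => /eqP ->.
by rewrite gt0_mulye// normc_gamma_kernel_gt0.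
Qed.

Lemma Gamma_integral_Beta :
  Gamma_integral a * Gamma_integral b = Gamma_integral (a + b) * Beta a b.
Proof.
have ab0 : 0 < Re (a + b) by rewrite ReD addr_gt0.
rewrite !Gamma_integralE.
have ia := cintegrable_gamma_kernel a_gt0.
have ib := cintegrable_gamma_kernel b_gt0.
transitivity (cintegral mu setT (fun s => cintegral mu setT (fun t => F (s, t)))).
  rewrite mulrC -cintegralZl//; apply: eq_cintegral => s _ /=.
  have [i1 e1] := cintegral_affine (- s) ltr01 ib.
  have -> : (fun t => F (s, t)) =
      (fun t => gamma_kernel a s * gamma_kernel b (1 * t + - s)).
    by apply/funext => t; rewrite /F /= mul1r.
  by rewrite cintegralZl// e1 rmorph1 mul1r mulrC.
rewrite cFubini1// -cFubini2//.
rewrite mulrC -cintegralZl//; last exact: cintegrable_gamma_kernel.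
apply: eq_cintegral => t _ /=.
have [t0|t0] := leP t 0.
  rewrite gamma_kernel0// mulr0.
  have -> : (fun s => F (s, t)) = (fun=> 0).
    by apply/funext => s; rewrite FE gamma_kernel0// mul0r.
  by rewrite /cintegral /Rintegral /= integral0.
have ti0 : 0 < t^-1 by rewrite invr_gt0.
have [i1 e1] := cintegral_affine 0 ti0 cintegrable_beta_kernel.
have -> : (fun s => F (s, t)) = (fun s => gamma_kernel (a + b) t * (t^-1)%:C *
    beta_kernel a b (t^-1 * s + 0)).
  by apply/funext => s; rewrite FE mulrA addr0.
by rewrite cintegralZl// -mulrA -e1 mulrC.
Qed.

End BetaFormula.

Section RealAndComplexParameters.
Context {R : realType}.
Local Notation mu := (@lebesgue_measure R).
Local Notation TR := (measurableTypeR R).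
Implicit Types (a b z : R[i]).

Lemma normc_gamma_kernel_integral z : 0 < Re z ->
  (\int[mu]_t (normc (gamma_kernel z t))%:E =
   (normc (Gamma_integral (Re z)%:C))%:E)%E.
Proof.
move=> z0; rewrite Gamma_integralE.
have -> : gamma_kernel (Re z)%:C = (fun t => (normc (gamma_kernel z t))%:C).
  by apply/funext => t; rewrite normc_gamma_kernel.
rewrite cintegral_normc normc_real ger0_norm; last first.
  by apply: fine_ge0; apply: integral_ge0 => t _; rewrite lee_fin normc_ge0.
rewrite fineK// ge0_fin_numE; last first.
  by apply: integral_ge0 => t _; rewrite lee_fin normc_ge0.
by have [] := (cintegrableP mu _ measurableT).1 (cintegrable_gamma_kernel z0).
Qed.

Lemma normc_beta_kernel_integral a b : 0 < Re a -> 0 < Re b ->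
  (\int[mu]_t (normc (beta_kernel a b t))%:E =
   (normc (Beta (Re a)%:C (Re b)%:C))%:E)%E.
Proof.
move=> a0 b0; rewrite /Beta.
have -> : beta_kernel (Re a)%:C (Re b)%:C =
    (fun t => (normc (beta_kernel a b t))%:C).
  by apply/funext => t; rewrite normc_beta_kernel.
rewrite cintegral_normc normc_real ger0_norm; last first.
  by apply: fine_ge0; apply: integral_ge0 => t _; rewrite lee_fin normc_ge0.
rewrite fineK// ge0_fin_numE; last first.
  by apply: integral_ge0 => t _; rewrite lee_fin normc_ge0.
by have [] := (cintegrableP mu _ measurableT).1 (cintegrable_beta_kernel a0 b0).
Qed.

Lemma normc_Gamma_integral_real_gt0 z : 0 < Re z ->
  0 < normc (Gamma_integral (Re z)%:C).
Proof.
move=> z0; rewrite -lte_fin -normc_gamma_kernel_integral//.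
exact: normc_gamma_kernel_gt0.
Qed.

Lemma normc_Gamma_integral_le z : 0 < Re z ->
  normc (Gamma_integral z) <= normc (Gamma_integral (Re z)%:C).
Proof.
move=> z0; rewrite -lee_fin -[leRHS](normc_gamma_kernel_integral z0).
rewrite Gamma_integralE.
by apply: normc_cintegral_le => //; exact: cintegrable_gamma_kernel.
Qed.

Lemma normc_Beta_le a b : 0 < Re a -> 0 < Re b ->
  normc (Beta a b) <= normc (Beta (Re a)%:C (Re b)%:C).
Proof.
move=> a0 b0; rewrite -lee_fin -[leRHS](normc_beta_kernel_integral a0 b0).
by apply: normc_cintegral_le => //; exact: cintegrable_beta_kernel.
Qed.

End RealAndComplexParameters.

(** * Recurrence for Gamma *)

Section GammaRecurrence.
Context {R : realType}.
Local Notation mu := (@lebesgue_measure R).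
Local Notation TR := (measurableTypeR R).
Implicit Types (a b z : R[i]).

Lemma Gamma_integral1 : Gamma_integral (1 : R[i]) = 1.
Proof.
have -> : Gamma_integral (1 : R[i]) =
    cintegral mu setT (fun t => (normc (gamma_kernel 1 t))%:C).
  rewrite Gamma_integralE; apply: eq_cintegral => t _.
  by rewrite normc_gamma_kernel.
rewrite cintegral_normc.
suff -> : (\int[mu]_t (normc (gamma_kernel (1 : R[i]) t))%:E = 1)%E by [].
rewrite -(@integral_exponential_pdf R 1)//.
transitivity (\int[mu]_(t in `]0%R, +oo[) (expR (- t))%:E)%E.
  rewrite [RHS]integral_mkcond; apply: eq_integral => t _; rewrite patchE.
  rewrite /gamma_kernel /czero_ext; case: ifP => _; last by rewrite Normc.normc0.
  by rewrite subrr cpow0 mul1r normc_real ger0_norm ?expR_ge0.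
rewrite integral_itv_obnd_cbnd; last first.
  by apply/measurable_EFinP; apply: measurable_funTS; apply: measurableT_comp.
rewrite integral_mkcond; apply: eq_integral => t _.
rewrite /exponential_pdf !patchE; case: ifP => // _.
by rewrite mul1r mulN1r.
Qed.

(** The integral of a power over the unit interval is computed from its part
    above one half, where the integrand is smooth: rescaling by two shows that
    the part below one half is the fraction 2^(-z) of the whole. *)
Lemma mul_Beta1 z : 0 < Re z -> z * Beta z 1 = 1.
Proof.
move=> z0.
have z1 : 0 < Re (1 : R[i]) by rewrite /= ltr01.
have ib := cintegrable_beta_kernel z0 z1.
have two0 : (0 : R) < 2 by [].
have [ib2 eb2] := cintegral_affine 0 two0 ib.
pose h : R := 2^-1; have h0 : 0 < h by rewrite /h; lra.
have h1 : h < 1 by rewrite /h; lra.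
pose f (t : TR) := beta_kernel z 1 t - cpow h (z - 1) * beta_kernel z 1 (2 * t + 0).
have fE : f = czero_ext `[h, 1[%classic (fun t => cpow t (z - 1)).
  apply/funext => t; rewrite /f /czero_ext addr0.
  have [t0|t0] := leP t 0.
    rewrite !beta_kernel0 ?mulr0 ?subr0; last 2 first.
    - by apply/negP => /andP[? ?]; lra.
    - by apply/negP => /andP[? ?]; lra.
    by rewrite memNset//= in_itv/= => /andP[? ?]; lra.
  have [t1|t1] := leP 1 t.
    rewrite !beta_kernel0 ?mulr0 ?subr0; last 2 first.
    - by apply/negP => /andP[? ?]; lra.
    - by apply/negP => /andP[? ?]; lra.
    by rewrite memNset//= in_itv/= => /andP[? ?]; lra.
  rewrite (@beta_kernelE _ z 1 t); last by rewrite t0 t1.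
  rewrite subrr cpow0 mulr1.
  have [th|th] := ltP t h.
    rewrite memNset/=; last by rewrite in_itv/= => /andP[? ?]; lra.
    rewrite beta_kernelE; last by apply/andP; split; move: th; rewrite /h; lra.
    rewrite subrr cpow0 mulr1 -cpowM//; last by lra.
    by rewrite mulrA mulVf// mul1r subrr.
  rewrite mem_set/=; last by rewrite in_itv/= th t1.
  rewrite beta_kernel0 ?mulr0 ?subr0//.
  by apply/negP => /andP[? ?]; move: th; rewrite /h; lra.
have intf : cintegrable mu setT f.
  by apply: cintegrableB => //; exact: cintegrableZl.
have If : cintegral mu setT f = (1 - cpow h z) * Beta z 1.
  rewrite cintegralB//; last exact: cintegrableZl.
  rewrite cintegralZl// /Beta eb2.
  have -> : cpow h z = cpow h (z - 1) * h%:C by rewrite -(cpow1 h0) -cpowD subrK.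
  have -> : (2 : R)%:C = (h%:C)^-1 by rewrite /h fmorphV invrK.
  have hC : h%:C != 0 by rewrite eq_complex /= gt_eqF.
  by field.
have Ipow : z * cintegral mu setT f = 1 - cpow h z.
  rewrite fE -cintegral_mkcond -cintegralZl//; last first.
    by apply/cintegrable_mkcond => //; rewrite -fE.
  have ip : cintegrable mu `[h, 1[%classic (fun t => z * cpow t (z - 1)).
    by apply: cintegrableZl => //; apply/cintegrable_mkcond => //; rewrite -fE.
  have part k (w : R[i] -> R) : (forall u, w u = Re (k * u)) ->
      Rintegral mu `[h, 1[%classic (fun t => w (z * cpow t (z - 1))) =
      w (1 - cpow h z).
    move=> wE; have mI : measurable (`[h, 1[%classic : set TR) by [].
    have [ir _] := cintegrableZl k mI ip.
    under eq_Rintegral do rewrite wE.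
    rewrite Rintegral_itv_bndo_bndc//.
    by rewrite /Rintegral integral_cpow// wE.
  have pr := part 1 (@complex.Re R)
    (fun u => congr1 (@complex.Re R) (esym (mul1r u))).
  have pim : forall u : R[i], Im u = Re (- 'i%C * u).
    by move=> u; rewrite ReM /= oppr0 mul0r sub0r mulN1r opprK.
  by apply: complex_ext; [exact: pr|exact: (part _ (@complex.Im R) pim)].
have n1 : 1 - cpow h z != 0.
  rewrite subr_eq0; apply/eqP => e.
  have := normc_cpow h z; rewrite -e Normc.normc1 => e1.
  have : expR (Re z * ln h) < 1.
    by rewrite -expR0 ltr_expR pmulr_rlt0// ln_lt0// h0 h1.
  by rewrite -e1 ltxx.
apply: (mulfI n1); rewrite mulr1 -[in RHS]Ipow If; ring.
Qed.

Lemma Gamma_integralS z : 0 < Re z ->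
  Gamma_integral (z + 1) = z * Gamma_integral z.
Proof.
move=> z0; have z1 : 0 < Re (1 : R[i]) by rewrite /= ltr01.
have := Gamma_integral_Beta z0 z1; rewrite Gamma_integral1 mulr1 => ->.
by rewrite mulrCA mul_Beta1// mulr1.
Qed.

End GammaRecurrence.

(** * Gamma has no zero in the right half-plane *)

Section GammaNonvanishing.
Context {R : realType}.
Local Notation mu := (@lebesgue_measure R).
Local Notation TR := (measurableTypeR R).
Implicit Types (a b z : R[i]).

Lemma normr_sin_le (x : R) : `|sin x| <= `|x|.
Proof.
wlog x0 : x / 0 <= x.
  move=> H; have [/H//|/ltW] := leP 0 x.
  by rewrite -oppr_ge0 => /H; rewrite sinN !normrN.
have [->|xn0] := eqVneq x 0; first by rewrite sin0 normr0.
have xp : 0 < x by rewrite lt_neqAle eq_sym xn0.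
have cs : {within `[0, x], continuous (@sin R)}.
  by apply: continuous_subspaceT; exact: continuous_sin.
have [c _] := MVT xp (fun y _ => is_derive_sin y) cs.
rewrite sin0 !subr0 => ->; rewrite normrM ler_piMl//.
by rewrite ler_norml cos_geN1 cos_le1.
Qed.

Lemma cos_ge1B (x : R) : 1 - x ^+ 2 / 2 <= cos x.
Proof.
have -> : cos x = 1 - sin (x / 2) ^+ 2 * 2.
  have {1}-> : x = (x / 2) *+ 2 by rewrite -mulr_natr divfK.
  by rewrite cos_mulr2n -mulr_natr; have := cos2Dsin2 (x / 2); lra.
have : sin (x / 2) ^+ 2 <= (x / 2) ^+ 2.
  rewrite -(real_normK (num_real (sin _))) -(real_normK (num_real (x / 2))).
  by rewrite ler_sqr ?nnegrE// normr_sin_le.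
by move=> h; rewrite lerD2l lerN2; move: h; rewrite expr_div_n; lra.
Qed.

(** With v = (ln u) / 2 the right-hand side is (2 (e^v - e^(-v)))^2. *)
Lemma sqr_ln_le (u : R) : 0 < u -> ln u ^+ 2 <= 4 * (u - 2 + u^-1).
Proof.
move=> u0; set v := ln u / 2.
have vE : ln u = v * 2 by rewrite /v divfK.
have uE : u = expR v ^+ 2 by rewrite -expRM_natr -vE lnK.
have iE : u^-1 = expR (- v) ^+ 2 by rewrite expRN exprVn -uE.
have vv : expR v * expR (- v) = 1 by rewrite -expRD subrr expR0.
have -> : u - 2 + u^-1 = (expR v - expR (- v)) ^+ 2.
  rewrite iE {1}uE sqrrB vv; ring.
suff h : `|v| <= `|expR v - expR (- v)|.
  have : v ^+ 2 <= (expR v - expR (- v)) ^+ 2.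
    rewrite -(real_normK (num_real v)) -[leRHS](real_normK (num_real _)).
    by rewrite ler_sqr ?nnegrE.
  move=> hv; rewrite vE (_ : (v * 2) ^+ 2 = 4 * v ^+ 2); last by ring.
  lra.
have key (w : R) : 0 <= w -> w <= expR w - expR (- w).
  move=> w0; have := expR_ge1Dx w.
  have : expR (- w) <= 1 by rewrite -expR0 ler_expR oppr_le0.
  lra.
have [v0|v0] := leP 0 v.
  by rewrite ger0_norm// (le_trans (key v v0))// ler_norm.
rewrite ltr0_norm// distrC -[in expR v](opprK v).
by apply: (le_trans (key (- v) _)); [rewrite oppr_ge0 ltW|rewrite ler_norm].
Qed.

Lemma Gamma_integral_real (r : R) : 0 < r ->
  Gamma_integral r%:C = (normc (Gamma_integral r%:C))%:C.
Proof.
move=> r0; have E : Gamma_integral r%:C =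
    cintegral mu setT (fun t => (normc (gamma_kernel r%:C t))%:C).
  rewrite Gamma_integralE; apply: eq_cintegral => t _.
  by rewrite normc_gamma_kernel.
rewrite E cintegral_normc normc_real ger0_norm//.
by apply: fine_ge0; apply: integral_ge0 => t _; rewrite lee_fin normc_ge0.
Qed.

(** For large Re z the law with density proportional to t^(Re z - 1) e^(-t)
    concentrates near t = Re z on a logarithmic scale, so after the rotation by
    (Re z)^(-i Im z) the integrand has a positive real part on average.  The
    bounds cos x >= 1 - x^2/2 and (ln u)^2 <= 4 (u - 2 + 1/u) with u = t / Re z
    make this quantitative through Gamma integrals at Re z - 1, Re z and
    Re z + 1 only. *)
Lemma Gamma_integral_neq0_large z :
  1 + 2 * Im z ^+ 2 < Re z -> Gamma_integral z != 0.
Proof.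
set s := Re z; set tau := Im z => zl.
have tau2 : 0 <= tau ^+ 2 by rewrite sqr_ge0.
have s1 : 1 < s by apply: le_lt_trans zl; rewrite lerDl mulr_ge0.
have s0 : 0 < s by lra.
have sm0 : 0 < s - 1 by lra.
pose g (r : R) : TR -> R[i] := gamma_kernel r%:C.
have ig r : 0 < r -> cintegrable mu setT (g r).
  by move=> r0; exact: cintegrable_gamma_kernel.
pose c : R[i] := cpow s (- (0 +i* tau)).
pose p : R := 1 + 4 * tau ^+ 2.
pose q : R := 2 * tau ^+ 2 / s.
pose w : R := 2 * tau ^+ 2 * s.
(* Pointwise, comb is the Gamma kernel at s times 1 - 2 tau^2 (u - 2 + 1/u)
   with u = t / s. *)
pose comb (t : TR) : R[i] := p%:C * g s t - q%:C * g (s + 1) t - w%:C * g (s - 1) t.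
have pos t : 0 <= Re (c * gamma_kernel z t - comb t).
  have [t0|t0] := leP t 0.
    by rewrite /comb /g !gamma_kernel0// !mulr0 !subr0.
  pose k := expR ((s - 1) * ln t) * expR (- t).
  have k0 : 0 <= k by rewrite mulr_ge0 ?expR_ge0.
  have gE r : g r t = (expR ((r - 1) * ln t) * expR (- t))%:C.
    by rewrite /g gamma_kernelE// rmorphM /= -cpow_realE rmorphB.
  have gs : g s t = k%:C by rewrite gE.
  have gs1 : g (s + 1) t = (t * k)%:C.
    rewrite gE addrK /k mulrA; congr (_ * _)%:C.
    by rewrite -{2}(lnK t0) -expRD; congr expR; ring.
  have gsm : g (s - 1) t = (t^-1 * k)%:C.
    rewrite gE /k mulrA; congr (_ * _)%:C.
    by rewrite -{2}(lnK t0) -expRN -expRD; congr expR; ring.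
  have cE : Re (c * gamma_kernel z t) = k * cos (tau * ln (t / s)).
    have Re_mulr (v : R[i]) r : Re (v * r%:C) = Re v * r.
      by rewrite ReM /= mulr0 subr0.
    rewrite gamma_kernelE// /c mulrA Re_mulr.
    rewrite ReM !Re_cpow !Im_cpow !ReN !ImN ReB ImB /= oppr0 !mul0r expR0 !mul1r.
    rewrite addr0 -/s -/tau ln_div ?posrE// mulrBr cosB /k !mulNr sinN cosN.
    ring.
  have combE : Re (comb t) = k * (p - q * t - w * t^-1).
    by rewrite /comb gs gs1 gsm !ReB -!rmorphM /=; ring.
  rewrite ReB cE combE -mulrBr mulr_ge0// subr_ge0.
  apply: le_trans (cos_ge1B _).
  have u0 : 0 < t / s by rewrite divr_gt0.
  have := ler_wpM2l tau2 (sqr_ln_le u0).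
  rewrite exprMn invf_div => h.
  have -> : p - q * t - w * t^-1 = 1 - 2 * (tau ^+ 2 * (t / s - 2 + s / t)).
    by rewrite /p /q /w; ring.
  lra.
have i1 : cintegrable mu setT (fun t => p%:C * g s t).
  by apply: cintegrableZl => //; exact: ig.
have i2 : cintegrable mu setT (fun t => q%:C * g (s + 1) t).
  by apply: cintegrableZl => //; apply: ig; lra.
have i3 : cintegrable mu setT (fun t => w%:C * g (s - 1) t).
  by apply: cintegrableZl => //; exact: ig.
have i12 := cintegrableB measurableT i1 i2.
have ic : cintegrable mu setT comb := cintegrableB measurableT i12 i3.
have iz : cintegrable mu setT (gamma_kernel z) by exact: cintegrable_gamma_kernel.
have icz : cintegrable mu setT (fun t => c * gamma_kernel z t).
  exact: cintegrableZl.
have := Re_cintegral_ge0 mu (fun t (_ : setT t) => pos t).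
rewrite cintegralB// cintegralZl// -Gamma_integralE => H.
apply/eqP => z0; move: H; rewrite z0 mulr0 sub0r ReN oppr_ge0; apply/negP.
rewrite -ltNge.
rewrite cintegralB// cintegralB// !cintegralZl//; try (apply: ig; lra).
rewrite -!Gamma_integralE.
have G1 : Gamma_integral (s + 1)%:C = s%:C * Gamma_integral s%:C.
  by rewrite rmorphD /= Gamma_integralS.
have G2 : Gamma_integral s%:C = (s - 1)%:C * Gamma_integral (s - 1)%:C.
  have e : (s - 1)%:C + 1 = s%:C by rewrite rmorphB rmorph1 subrK.
  by rewrite -Gamma_integralS // e.
set G := Gamma_integral (s - 1)%:C in G2 *.
have [x x0 GE] : exists2 x : R, 0 < x & G = x%:C.
  exists (normc G); first exact: (@normc_Gamma_integral_real_gt0 _ (s - 1)%:C).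
  exact: Gamma_integral_real.
rewrite G1 G2 GE !ReB -!rmorphM /=.
have -> : p * ((s - 1) * x) - q * (s * ((s - 1) * x)) - w * x =
    ((s - 1) - 2 * tau ^+ 2) * x.
  by rewrite /p /q /w; field; rewrite gt_eqF.
by rewrite mulr_gt0//; lra.
Qed.

End GammaNonvanishing.

(** * Moduli of Gamma and Beta along horizontal lines *)

Section GammaBetaConsequences.
Context {R : realType}.
Local Notation mu := (@lebesgue_measure R).
Local Notation TR := (measurableTypeR R).
Implicit Types (a b z : R[i]).

(** The recurrence moves z to the right, into the range of the previous lemma. *)
Lemma Gamma_integral_neq0 z : 0 < Re z -> Gamma_integral z != 0.
Proof.
have [n] : exists n, 1 + 2 * Im z ^+ 2 < Re z + n%:R.
  exists (Num.truncn (1 + 2 * Im z ^+ 2 - Re z)).+1.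
  by have := truncnS_gt (1 + 2 * Im z ^+ 2 - Re z); lra.
elim: n z => [z|n IH z] zl z0.
  by apply: Gamma_integral_neq0_large; rewrite -[Re z]addr0.
have := IH (z + 1); rewrite Gamma_integralS// mulf_eq0 negb_or => H.
have /andP[//] : (z != 0) && (Gamma_integral z != 0).
apply: H; rewrite ReD /= ?ImD ?addr0; last lra.
by move: zl; rewrite -natr1; lra.
Qed.

Lemma GammaE z : 0 < Re z -> Gamma z = Gamma_integral z.
Proof.
move=> z0; rewrite /Gamma.
have -> : Num.truncn (1 - Re z) = 0%N.
  by apply/truncn0Pn; rewrite -ltNge gtrBl.
by rewrite big_ord0 divr1 addr0.
Qed.

Lemma Gamma_neq0 z : 0 < Re z -> Gamma z != 0.
Proof. by move=> z0; rewrite GammaE// Gamma_integral_neq0. Qed.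

Lemma pochhammerE z (l : R) : 0 < Re z ->
  pochhammer z l = Gamma (z + l%:C) / Gamma z.
Proof.
move=> z0; rewrite /pochhammer asboolF// => -[k zk]; move: z0.
by rewrite zk ReN Re_nat oppr_gt0 ltrn0.
Qed.

Lemma BetaE a b : 0 < Re a -> 0 < Re b ->
  Beta a b = Gamma a * Gamma b / Gamma (a + b).
Proof.
move=> a0 b0; have ab0 : 0 < Re (a + b) by rewrite ReD addr_gt0.
rewrite !GammaE// Gamma_integral_Beta// mulrC mulKf//.
exact: Gamma_integral_neq0.
Qed.

Lemma normc_BetaE a b : 0 < Re a -> 0 < Re b -> normc (Beta a b) =
  normc (Gamma a) * normc (Gamma b) / normc (Gamma (a + b)).
Proof.
move=> a0 b0; rewrite BetaE// Normc.normcM Normc.normcV.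
by rewrite (Normc.normcM (Gamma a)).
Qed.

(** The ratio |Gamma z| / Gamma (Re z) grows along horizontal lines: the
    triangle inequality for the integral defining Beta a s bounds
    |Gamma a Gamma s / Gamma (a + s)| by the same expression at Re a. *)
Lemma normc_Gamma_ratio a (s : R) : 0 < Re a -> 0 <= s ->
  normc (Gamma a) * normc (Gamma (Re a + s)%:C) <=
  normc (Gamma (a + s%:C)) * normc (Gamma (Re a)%:C).
Proof.
move=> a0; rewrite le_eqVlt => /predU1P[<-|s0]; first by rewrite !addr0.
have sC : 0 < Re s%:C by [].
have rC : 0 < Re (Re a)%:C by [].
have as0 : 0 < Re (a + s%:C) by rewrite ReD addr_gt0.
have rs0 : 0 < Re ((Re a)%:C + s%:C) by rewrite ReD addr_gt0.
have := normc_Beta_le a0 sC; rewrite -[(Re s%:C)%:C]/(s%:C) !normc_BetaE//.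
rewrite (_ : (Re a)%:C + s%:C = (Re a + s)%:C); last by rewrite rmorphD.
have gs : 0 < normc (Gamma s%:C) by rewrite normc_gt0 Gamma_neq0.
have g1 : 0 < normc (Gamma (a + s%:C)) by rewrite normc_gt0 Gamma_neq0.
have g2 : 0 < normc (Gamma (Re a + s)%:C).
  by rewrite normc_gt0 Gamma_neq0//= addr_gt0.
have clear_denominators (A B S P Q : R) : 0 < S -> 0 < P -> 0 < Q ->
    A * S / P <= B * S / Q -> A * Q <= P * B.
  move=> S0 P0 Q0; rewrite ler_pdivrMr// [leRHS]mulrAC ler_pdivlMr// => h.
  by rewrite -(ler_pM2r S0); lra.
exact: clear_denominators gs g1 g2.
Qed.

(** By monotonicity of the ratio |Gamma| / Gamma o Re in the numerator and
    |Gamma z| <= Gamma (Re z) in the denominator, absolute values inside a Beta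
    integral cost only a constant factor, uniformly in the shifts s and t. *)
Lemma normc_Beta_comparable a b : 0 < Re a -> 0 < Re b ->
  exists2 C : R, 0 <= C & forall s t : R, 0 <= s -> 0 <= t ->
    normc (Beta (Re a + s)%:C (Re b + t)%:C) <=
    C * normc (Beta (a + s%:C) (b + t%:C)).
Proof.
move=> a0 b0.
have ga : 0 < normc (Gamma a) by rewrite normc_gt0 Gamma_neq0.
have gb : 0 < normc (Gamma b) by rewrite normc_gt0 Gamma_neq0.
exists (normc (Gamma (Re a)%:C) / normc (Gamma a) *
        (normc (Gamma (Re b)%:C) / normc (Gamma b))).
  by rewrite mulr_ge0// divr_ge0// normc_ge0.
move=> s t s0 t0.
have as0 : 0 < Re (a + s%:C) by rewrite ReD ltr_pwDl.
have bt0 : 0 < Re (b + t%:C) by rewrite ReD ltr_pwDl.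
have asr0 : 0 < Re (Re a + s)%:C by rewrite /= ltr_pwDl.
have btr0 : 0 < Re (Re b + t)%:C by rewrite /= ltr_pwDl.
have ab0 : 0 < Re (a + s%:C + (b + t%:C)) by rewrite ReD addr_gt0.
have abr0 : 0 < Re ((Re a + s)%:C + (Re b + t)%:C) by rewrite ReD addr_gt0.
rewrite !normc_BetaE//.
have ra : normc (Gamma (Re a + s)%:C) <=
    normc (Gamma (Re a)%:C) / normc (Gamma a) * normc (Gamma (a + s%:C)).
  rewrite mulrAC ler_pdivlMr// mulrC [leRHS]mulrC.
  exact: normc_Gamma_ratio.
have rb : normc (Gamma (Re b + t)%:C) <=
    normc (Gamma (Re b)%:C) / normc (Gamma b) * normc (Gamma (b + t%:C)).
  rewrite mulrAC ler_pdivlMr// mulrC [leRHS]mulrC.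
  exact: normc_Gamma_ratio.
have rab : (normc (Gamma ((Re a + s)%:C + (Re b + t)%:C)))^-1 <=
    (normc (Gamma (a + s%:C + (b + t%:C))))^-1.
  rewrite lef_pV2 ?posrE ?normc_gt0 ?Gamma_neq0//.
  rewrite !GammaE//; have := normc_Gamma_integral_le ab0.
  rewrite (_ : (Re (a + s%:C + (b + t%:C)))%:C = (Re a + s)%:C + (Re b + t)%:C)//.
  by rewrite -rmorphD !ReD.
set C1 := _ / _ in ra *; set C2 := _ / _ in rb *.
rewrite [leRHS](_ : _ = (C1 * normc (Gamma (a + s%:C))) *
    (C2 * normc (Gamma (b + t%:C))) / normc (Gamma (a + s%:C + (b + t%:C)))).
  apply: ler_pM => //; [by rewrite mulr_ge0 ?normc_ge0|
    by rewrite invr_ge0 normc_ge0|by apply: ler_pM; rewrite ?normc_ge0].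
by ring.
Qed.

End GammaBetaConsequences.

(** * Products of Beta integrals and double series *)

Section SquareIntegral.
Context {R : realType}.
Local Notation mu := (@lebesgue_measure R).
Local Notation TR := (measurableTypeR R).
Implicit Types (a b : R[i]).

Definition euler_integrand a b c e (p : TR * TR) : R[i] :=
  (cpow p.1 (a - 1) * cpow (1 - p.1) (b - 1)) *
  (cpow p.2 (c - 1) * cpow (1 - p.2) (e - 1)).

Lemma cintegral_euler_integrand a b c e :
  0 < Re a -> 0 < Re b -> 0 < Re c -> 0 < Re e ->
  cintegrable lebesgue2 unit_square (euler_integrand a b c e) /\
  cintegral lebesgue2 unit_square (euler_integrand a b c e) =
    Beta a b * Beta c e.
Proof.
move=> a0 b0 c0 e0.
pose k a b (t : TR) : R[i] := cpow t (a - 1) * cpow (1 - t) (b - 1).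
have ik a' b' : 0 < Re a' -> 0 < Re b' -> cintegrable mu `]0, 1[%classic (k a' b').
  by move=> ? ?; apply/cintegrable_mkcond => //; exact: cintegrable_beta_kernel.
have m01 : measurable (`]0, 1[%classic : set TR) by [].
have [i1 e1] := cintegral_prod m01 m01 (ik _ _ a0 b0) (ik _ _ c0 e0).
by split=> //; rewrite e1 [X in X * _]cintegral_mkcond [X in _ * X]cintegral_mkcond.
Qed.

Lemma normc_euler_integrand a b c e p :
  (normc (euler_integrand a b c e p))%:C =
  euler_integrand (Re a)%:C (Re b)%:C (Re c)%:C (Re e)%:C p.
Proof.
rewrite /euler_integrand !Normc.normcM !rmorphM /= !normc_cpow_realE !ReB.
by rewrite !rmorphB.
Qed.

Lemma integral_normc_euler_integrand a b c e :
  0 < Re a -> 0 < Re b -> 0 < Re c -> 0 < Re e ->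
  (\int[lebesgue2]_(p in unit_square) (normc (euler_integrand a b c e p))%:E =
   (normc (Beta (Re a)%:C (Re b)%:C) * normc (Beta (Re c)%:C (Re e)%:C))%:E)%E.
Proof.
move=> a0 b0 c0 e0.
have [i1 _] := cintegral_euler_integrand a0 b0 c0 e0.
have [_ E] := @cintegral_euler_integrand
  (Re a)%:C (Re b)%:C (Re c)%:C (Re e)%:C a0 b0 c0 e0.
have ms : measurable (unit_square : set (TR * TR)) by exact: measurableX.
have I0 : (0 <= \int[lebesgue2]_(p in unit_square)
    (normc (euler_integrand a b c e p))%:E)%E.
  by apply: integral_ge0 => p _; rewrite lee_fin normc_ge0.
have Ifin : (\int[lebesgue2]_(p in unit_square)
    (normc (euler_integrand a b c e p))%:E)%E \is a fin_num.
  by rewrite ge0_fin_numE//; have [] := (cintegrableP lebesgue2 _ ms).1 i1.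
rewrite -[LHS]fineK// -Normc.normcM -E; congr _%:E.
rewrite -[LHS]ger0_norm ?fine_ge0// -normc_real -cintegral_normc; congr normc.
by apply: eq_cintegral => p _; rewrite normc_euler_integrand.
Qed.

End SquareIntegral.

Section SummablePairs.
Context {R : realType}.

Lemma summable_pairs (a : nat -> nat -> R) : (forall m n, 0 <= a m n) ->
  summable [set: nat * nat] (fun p => (a p.1 p.2)%:E) ->
  (\sum_(0 <= m <oo) \sum_(0 <= n <oo) (a m n)%:E < +oo)%E /\
  forall m, (\sum_(0 <= n <oo) (a m n)%:E < +oo)%E.
Proof.
move=> a0 sa.
have E : (\sum_(0 <= m <oo) \sum_(0 <= n <oo) (a m n)%:E =
    \esum_(p in [set: nat * nat]) (a p.1 p.2)%:E)%E.
  rewrite nneseries_esumT; last first.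
    by move=> m; apply: nneseries_ge0 => n _ _; rewrite lee_fin.
  transitivity (\esum_(m in [set: nat]) \esum_(n in [set: nat]) (a m n)%:E)%E.
    by apply: eq_esum => m _; rewrite nneseries_esumT// => n; rewrite lee_fin.
  have := @esum_esum R nat nat setT (fun=> setT) (fun m n => (a m n)%:E)
    (fun m n _ _ => a0 m n).
  by move=> /= ->; congr esum; apply/seteqP.
have s1 : (\sum_(0 <= m <oo) \sum_(0 <= n <oo) (a m n)%:E < +oo)%E.
  rewrite E; move: sa; rewrite /summable.
  by under eq_esum do rewrite gee0_abs ?lee_fin//.
split=> // m; apply: le_lt_trans s1.
have n0 k : (0 <= \sum_(0 <= n <oo) (a k n)%:E)%E.
  by apply: nneseries_ge0 => n _ _; rewrite lee_fin.
apply: (@le_trans _ _ (\sum_(0 <= k < m.+1) \sum_(0 <= n <oo) (a k n)%:E)%E).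
  by rewrite big_nat_recr//= leeDr// sume_ge0.
by apply: nneseries_lim_ge.
Qed.

End SummablePairs.

(** Termwise integration is applied to the sum over n and then to the sum over m;
    the iterated series appears in this order on both sides. *)
Lemma cintegral_double_series d (T : measurableType d) (R : realType)
    (mu : {measure set T -> \bar R}) (D : set T) (f : nat -> nat -> T -> R[i])
    (C : R) (M : nat -> nat -> R) :
  measurable D -> (forall m n, cintegrable mu D (f m n)) ->
  0 <= C -> (forall m n, 0 <= M m n) ->
  (forall m n, (\int[mu]_(x in D) (normc (f m n x))%:E <= (C * M m n)%:E)%E) ->
  summable [set: nat * nat] (fun p => (M p.1 p.2)%:E) ->
  (forall m x, D x -> csummable (fun n => f m n x)) ->
  (forall x, D x -> csummable (fun m => cseries (fun n => f m n x))) ->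
  cintegrable mu D (fun x => cseries (fun m => cseries (fun n => f m n x))) /\
  cintegral mu D (fun x => cseries (fun m => cseries (fun n => f m n x))) =
    cseries (fun m => cseries (fun n => cintegral mu D (f m n))).
Proof.
move=> mD fi C0 M0 fM sM s1 s2.
have I0 m n : (0 <= \int[mu]_(x in D) (normc (f m n x))%:E)%E.
  by apply: integral_ge0 => x _; rewrite lee_fin normc_ge0.
have [MM M1] := summable_pairs M0 sM.
have MZ m : (\sum_(0 <= n <oo) (C * M m n)%:E =
    C%:E * \sum_(0 <= n <oo) (M m n)%:E)%E.
  under eq_eseriesr do rewrite EFinM.
  by rewrite nneseriesZl// => n _; rewrite lee_fin.
have le1 m : (\sum_(0 <= n <oo) \int[mu]_(x in D) (normc (f m n x))%:E <=
    C%:E * \sum_(0 <= n <oo) (M m n)%:E)%E.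
  by rewrite -MZ; apply: lee_nneseries.
have Clty m : (C%:E * \sum_(0 <= n <oo) (M m n)%:E < +oo)%E.
  by rewrite lte_mul_pinfty// lee_fin.
have inner m := cintegral_cseries mD (fi m) (s1 m) (le_lt_trans (le1 m) (Clty m)).
have hi m : cintegrable mu D (fun x => cseries (fun n => f m n x)).
  by have [] := inner m.
have le2 : (\sum_(0 <= m <oo)
    \int[mu]_(x in D) (normc (cseries (fun n => f m n x)))%:E < +oo)%E.
  apply: (@le_lt_trans _ _
      (\sum_(0 <= m <oo) C%:E * \sum_(0 <= n <oo) (M m n)%:E)%E).
    apply: lee_nneseries => m _.
      by move=> _; apply: integral_ge0 => x _; rewrite lee_fin normc_ge0.
    by apply: le_trans (le1 m); have [] := inner m.
  rewrite nneseriesZl => [|m _]; first by rewrite lte_mul_pinfty// lee_fin.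
  by apply: nneseries_ge0 => n _ _; rewrite lee_fin.
have [iF eF _] := cintegral_cseries mD hi s2 le2; split=> //.
rewrite eF; congr cseries; apply/funext => m.
by have [] := inner m.
Qed.

(** * Termwise integration *)

Lemma cpow_shift (R : realType) (t r : R) (z : R[i]) (m : nat) : 0 < t ->
  cpow t (z + (r * m%:R)%:C) = cpow t z * ((t `^ r)%:C) ^+ m.
Proof.
move=> t0; rewrite cpowD cpow_powR// powRrM powR_mulrn ?powR_ge0//.
by rewrite rmorphXn.
Qed.

Section Terms.
Context {R : realType}.
Variables (gamma1 gamma2 gamma3 delta1 delta2 delta3 x y : R[i]).
Variables (alpha2 alpha3 alpha4 beta1 beta2 beta4 : R).
Hypotheses (hgamma1 : 0 < Re gamma1) (hgamma2 : 0 < Re gamma2).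
Hypothesis hdelta1 : 0 < Re (delta1 - gamma1 - gamma2).
Hypotheses (halpha2 : 0 < alpha2) (hbeta1 : 0 < beta1).
Hypothesis halpha : 0 < alpha3 - alpha2.

Local Notation TR := (measurableTypeR R).

Let K := Gamma gamma1 * Gamma gamma2 * Gamma (delta1 - gamma1 - gamma2).

Let shift m n := (alpha3 - alpha2) * m%:R + beta1 * n%:R.

Let D1m := D1_term gamma1 (alpha3 - alpha2) beta1 gamma2 alpha2 gamma3 beta2
    delta1 alpha3 beta1 delta2 alpha4 delta3 beta4 x y.

(** The factor K^-1 makes the integral of each term exactly a term of D1. *)
Definition term_integrand m n (p : TR * TR) : R[i] :=
  K^-1 * pochhammer gamma3 (beta2 * n%:R) *
  (x ^+ m / Gamma (delta2 + (alpha4 * m%:R)%:C)) *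
  (y ^+ n / Gamma (delta3 + (beta4 * n%:R)%:C)) *
  euler_integrand (gamma2 + (alpha2 * m%:R)%:C)
    (delta1 - gamma2 + (shift m n)%:C)
    (gamma1 + (shift m n)%:C) (delta1 - gamma1 - gamma2) p.

Let hdg : 0 < Re (delta1 - gamma2).
Proof. by have := hdelta1; have := hgamma1; rewrite !ReB; lra. Qed.

Let shift_ge0 m n : 0 <= shift m n.
Proof. by rewrite addr_ge0// mulr_ge0// ltW. Qed.

Let a2_ge0 m : 0 <= alpha2 * m%:R.
Proof. by rewrite mulr_ge0// ltW. Qed.

Let Re_shift z (s : R) : 0 < Re z -> 0 <= s -> 0 < Re (z + s%:C).
Proof. by move=> z0 s0; rewrite ReD ltr_pwDl. Qed.

Let measurable_square : measurable (unit_square : set (TR * TR)).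
Proof. exact: measurableX. Qed.

Lemma cintegral_term m n :
  cintegrable lebesgue2 unit_square (term_integrand m n) /\
  cintegral lebesgue2 unit_square (term_integrand m n) = D1m m n.
Proof.
have [ie ee] := cintegral_euler_integrand
  (Re_shift hgamma2 (a2_ge0 m)) (Re_shift hdg (shift_ge0 m n))
  (Re_shift hgamma1 (shift_ge0 m n)) hdelta1.
split; first exact: cintegrableZl.
rewrite cintegralZl// ee !BetaE ?Re_shift//.
rewrite /D1m /D1_term (pochhammerE _ hgamma1) (pochhammerE _ hgamma2).
have -> : gamma2 + (alpha2 * m%:R)%:C + (delta1 - gamma2 + (shift m n)%:C) =
    delta1 + (alpha3 * m%:R + beta1 * n%:R)%:C.
  by rewrite addrACA -rmorphD addrCA subrr addr0 /shift; congr (_ + _%:C); ring.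
have -> : gamma1 + (shift m n)%:C + (delta1 - gamma1 - gamma2) =
    delta1 - gamma2 + (shift m n)%:C by ring.
have n1 : Gamma (delta1 - gamma2 + (shift m n)%:C) != 0.
  by rewrite Gamma_neq0 ?Re_shift.
rewrite /K -/(shift m n).
have n2 := Gamma_neq0 hgamma1; have n3 := Gamma_neq0 hgamma2.
have n4 := Gamma_neq0 hdelta1.
move: (Gamma (_ - gamma2 + _)) (Gamma gamma1) (Gamma gamma2)
  (Gamma (_ - gamma2)) n1 n2 n3 n4 => G0 G1 G2 G3 n1 n2 n3 n4.
move: (pochhammer _ _) (Gamma (delta1 + _))^-1 (Gamma (delta2 + _))^-1
  (Gamma (delta3 + _))^-1 => P1 P2 P3 P4.
by field; apply/and4P; split.
Qed.

(** The kernel at real parameters is compared with the complex one, factor by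
    factor; the coefficients in x and y are the same on both sides. *)
Lemma normc_term_bound : exists2 C : R, 0 <= C & forall m n,
  (\int[lebesgue2]_(p in unit_square) (normc (term_integrand m n p))%:E <=
   (C * normc (D1m m n))%:E)%E.
Proof.
have [C1 C1p h1] := normc_Beta_comparable hgamma2 hdg.
have [C2 C2p h2] := normc_Beta_comparable hgamma1 hdelta1.
exists (C1 * C2) => [|m n]; first by rewrite mulr_ge0.
have a0 := Re_shift hgamma2 (a2_ge0 m).
have b0 := Re_shift hdg (shift_ge0 m n).
have c0 := Re_shift hgamma1 (shift_ge0 m n).
have [ie ee] := cintegral_euler_integrand a0 b0 c0 hdelta1.
have [_ <-] := cintegral_term m n.
rewrite cintegralZl// ee.
rewrite /term_integrand; set k := _ * (y ^+ n / _).
under eq_integral do rewrite Normc.normcM EFinM.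
rewrite ge0_integralZl//; last 3 first.
- apply/measurable_EFinP; apply: cmeasurable_normc.
  by have [] := (cintegrableP _ _ measurable_square).1 ie.
- by move=> p _; rewrite lee_fin normc_ge0.
- by rewrite lee_fin normc_ge0.
rewrite (integral_normc_euler_integrand a0 b0 c0 hdelta1) -EFinM lee_fin.
rewrite (Normc.normcM k) (Normc.normcM (Beta _ _)) [leRHS]mulrCA.
rewrite ler_wpM2l ?normc_ge0//.
rewrite mulrACA; apply: ler_pM; rewrite ?normc_ge0//.
  by have := h1 _ _ (a2_ge0 m) (shift_ge0 m n); rewrite !ReD.
by have := h2 _ _ (shift_ge0 m n) (lexx 0); rewrite !ReD /= !addr0.
Qed.

Lemma term_integrandE m n (p : TR * TR) : unit_square p ->
  term_integrand m n p = K^-1 *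
   (cpow p.1 (gamma2 - 1) * cpow p.2 (gamma1 - 1)
      * cpow (1 - p.1) (delta1 - gamma2 - 1)
      * cpow (1 - p.2) (delta1 - gamma1 - gamma2 - 1)) *
   ML2_term alpha4 delta2
     (x * (p.1 `^ alpha2 * ((1 - p.1) * p.2) `^ (alpha3 - alpha2))%:C) m *
   ML4_term beta4 delta3 gamma3 beta2
     (y * ((1 - p.1) `^ beta1 * p.2 `^ beta1)%:C) n.
Proof.
case: p => s t [] /=; rewrite !in_itv/= => /andP[s0 s1] /andP[t0 t1].
have s1' : 0 < 1 - s by rewrite subr_gt0.
have E z (u : R) : z + u%:C - 1 = (z - 1) + u%:C by ring.
have F u z : 0 < u -> cpow u (z + (shift m n)%:C) =
    cpow u z * ((u `^ (alpha3 - alpha2))%:C) ^+ m * ((u `^ beta1)%:C) ^+ n.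
  by move=> u0; rewrite rmorphD addrA !cpow_shift.
rewrite /term_integrand /euler_integrand /= !E cpow_shift// !F//.
rewrite /ML2_term /ML4_term powRM ?ltW// !rmorphM /= !exprMn.
rewrite [delta2 + _]addrC [delta3 + _]addrC.
move: (Gamma (_ + delta2))^-1 (Gamma (_ + delta3))^-1 K^-1 (pochhammer _ _) => *.
by ring.
Qed.

End Terms.

Theorem mainTheorem11 (R : realType)
    (gamma1 gamma2 gamma3 delta1 delta2 delta3 x y : R[i])
    (alpha2 alpha3 alpha4 beta1 beta2 beta4 : R)
    (hgamma1 : 0 < complex.Re gamma1)
    (hgamma2 : 0 < complex.Re gamma2)
    (hdelta1 : 0 < complex.Re (delta1 - gamma1 - gamma2))
    (halpha2 : 0 < alpha2) (halpha3 : 0 < alpha3) (halpha4 : 0 < alpha4)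
    (hbeta1 : 0 < beta1) (hbeta2 : 0 < beta2) (hbeta4 : 0 < beta4)
    (halpha : 0 < alpha3 - alpha2) :
  let arg1 (xi eta : R) : R[i] :=
    x * (xi `^ alpha2 * ((1 - xi) * eta) `^ (alpha3 - alpha2))%:C in
  let arg2 (xi eta : R) : R[i] :=
    y * ((1 - xi) `^ beta1 * eta `^ beta1)%:C in
  let integrand (p : measurableTypeR R * measurableTypeR R) : R[i] :=
    let xi := p.1 in
    let eta := p.2 in
    cpow xi (gamma2 - 1) * cpow eta (gamma1 - 1)
      * cpow (1 - xi) (delta1 - gamma2 - 1)
      * cpow (1 - eta) (delta1 - gamma1 - gamma2 - 1)
      * ML2 alpha4 delta2 (arg1 xi eta)
      * ML4 beta4 delta3 gamma3 beta2 (arg2 xi eta) in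
  D1_summable gamma1 (alpha3 - alpha2) beta1 gamma2 alpha2 gamma3 beta2
    delta1 alpha3 beta1 delta2 alpha4 delta3 beta4 x y ->
  (forall xi eta : R, 0 < xi < 1 -> 0 < eta < 1 ->
    csummable (ML2_term alpha4 delta2 (arg1 xi eta)) /\
    csummable (ML4_term beta4 delta3 gamma3 beta2 (arg2 xi eta))) ->
  cintegrable lebesgue2 unit_square integrand /\
  D1 gamma1 (alpha3 - alpha2) beta1 gamma2 alpha2 gamma3 beta2
    delta1 alpha3 beta1 delta2 alpha4 delta3 beta4 x y
  = 1 / (Gamma gamma1 * Gamma gamma2 * Gamma (delta1 - gamma1 - gamma2))
    * cintegral lebesgue2 unit_square integrand.
Proof.
move=> arg1 arg2 integrand hD hML.
set K := Gamma gamma1 * Gamma gamma2 * Gamma (delta1 - gamma1 - gamma2).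
have K0 : K != 0.
  apply: mulf_neq0 (Gamma_neq0 hdelta1).
  exact: mulf_neq0 (Gamma_neq0 hgamma1) (Gamma_neq0 hgamma2).
have mS : measurable (unit_square : set (measurableTypeR R * measurableTypeR R)).
  exact: measurableX.
pose f m n := term_integrand gamma1 gamma2 gamma3 delta1 delta2 delta3 x y
  alpha2 alpha3 alpha4 beta1 beta2 beta4 m n.
have fT m n := cintegral_term gamma3 delta2 delta3 x y alpha4 beta2 beta4
  hgamma1 hgamma2 hdelta1 halpha2 hbeta1 halpha m n.
have [C C0 fC] := normc_term_bound gamma3 delta2 delta3 x y alpha4 beta2 beta4
  hgamma1 hgamma2 hdelta1 halpha2 hbeta1 halpha.
have sML p : unit_square p ->
    csummable (ML2_term alpha4 delta2 (arg1 p.1 p.2)) /\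
    csummable (ML4_term beta4 delta3 gamma3 beta2 (arg2 p.1 p.2)).
  by case: p => s t [] /=; rewrite !in_itv/= => hs ht; exact: hML.
pose w p := K^-1 *
  (cpow p.1 (gamma2 - 1) * cpow p.2 (gamma1 - 1)
    * cpow (1 - p.1) (delta1 - gamma2 - 1)
    * cpow (1 - p.2) (delta1 - gamma1 - gamma2 - 1)).
have fE m p : unit_square p -> (fun n => f m n p) = (fun n =>
    w p * ML2_term alpha4 delta2 (arg1 p.1 p.2) m *
    ML4_term beta4 delta3 gamma3 beta2 (arg2 p.1 p.2) n).
  by move=> Dp; apply/funext => n; rewrite /f term_integrandE.
have hE p : unit_square p -> (fun m => cseries (fun n => f m n p)) = (fun m =>
    w p * ML4 beta4 delta3 gamma3 beta2 (arg2 p.1 p.2) *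
    ML2_term alpha4 delta2 (arg1 p.1 p.2) m).
  move=> Dp; apply/funext => m; rewrite fE// cseriesZ; last exact: (sML p Dp).2.
  by rewrite mulrAC.
have s1 m p : unit_square p -> csummable (fun n => f m n p).
  by move=> Dp; rewrite fE//; apply: csummableZ; exact: (sML p Dp).2.
have s2 p : unit_square p -> csummable (fun m => cseries (fun n => f m n p)).
  by move=> Dp; rewrite hE//; apply: csummableZ; exact: (sML p Dp).1.
have [iF eF] := cintegral_double_series mS (fun m n => (fT m n).1) C0
  (fun m n => normc_ge0 _) fC hD s1 s2.
have FE p : unit_square p ->
    cseries (fun m => cseries (fun n => f m n p)) = K^-1 * integrand p.
  move=> Dp; rewrite hE// cseriesZ; last exact: (sML p Dp).1.
  by rewrite /integrand /w -/(ML2 _ _ _); ring.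
have iI : cintegrable lebesgue2 unit_square integrand.
  apply: eq_cintegrable (cintegrableZl K mS iF) => // p /[!inE] Dp.
  by rewrite FE// mulVKf.
split=> //; rewrite div1r -cintegralZl//.
transitivity (cintegral lebesgue2 unit_square
    (fun p => cseries (fun m => cseries (fun n => f m n p)))).
  rewrite eF /D1; congr cseries; apply/funext => m; congr cseries.
  by apply/funext => n; rewrite (fT m n).2.
by apply: eq_cintegral => p /[!inE] Dp; exact: FE.
Qed.
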